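(* Let $X$ be a uniformly locally finite $\mathrm{CAT}(0)$ cube complex with no extremal vertices, let $\mathcal{C}(X)$ be its contact graph, and let $\iota\colon \mathrm{Aut}\,X\to\mathrm{Aut}\,\mathcal{C}(X)$ be the natural homomorphism. (1) There exists a homomorphism $\rho\colon\mathrm{Aut}\,\mathcal{C}(X)\to S(X^{(0)})$ such that $\rho\circ\iota=\mathrm{id}_{\mathrm{Aut}\,X}$ (where $\mathrm{Aut}\,X$ is viewed as a subgroup of $S(X^{(0)})$). In particular, $\iota$ is injective. (2) Suppose in addition that no hyperplane of $X$ has extremal vertices. Then $\iota$ is a group isomorphism with inverse $\rho$.
   Context: $\mathrm{Aut}\,X$ is the group of cubical automorphisms of $X$, equivalently the automorphism group of the graph $X^{(1)}$; it is identified with a subgroup of the group $S(X^{(0)})$ of all permutations of the vertex set $X^{(0)}$. Uniformly locally finite means that there is a uniform upper bound on the number of edges incident to a vertex. An automorphism of a graph is a self-bijection of its vertex set preserving adjacency (in both directions). The carrier of a hyperplane $\mathfrak{w}$ is the union of all cubes of $X$ that intersect $\mathfrak{w}$. Two distinct hyperplanes are transverse if they intersect. The contact graph $\mathcal{C}(X)$ has the hyperplanes of $X$ as vertices, and two distinct hyperplanes are joined by an edge if and only if no third hyperplane separates them (equivalently, their carriers intersect). The action of $\mathrm{Aut}\,X$ on the set of hyperplanes induces the natural homomorphism $\iota$. For a vertex $v$, the link $\mathrm{lk}\,v$ is the graph with a vertex for each edge of $X$ incident to $v$, two being joined by an edge when the corresponding edges of $X$ span a square. A graph is a cone if it is the join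 of a (possibly empty) graph and a single vertex. A vertex $v$ of a $\mathrm{CAT}(0)$ cube complex is extremal if $\mathrm{lk}\,v$ is a cone; in particular any vertex that belongs to a single edge is extremal. Every hyperplane $\mathfrak{w}$ of $X$ is itself a $\mathrm{CAT}(0)$ cube complex whose cubes are the intersections of $\mathfrak{w}$ with cubes of $X$ (so vertices of $\mathfrak{w}$ correspond to edges of $X$ crossing $\mathfrak{w}$), and extremal vertices of $\mathfrak{w}$ are meant with respect to this structure. *)

(* Defs.v *)
From HB Require Import structures.
From Stdlib Require Export Relation_Operators.
From mathcomp Require Export all_boot.
From mathcomp Require Export boolp classical_sets functions cardinality.

Set Implicit Arguments.
Unset Strict Implicit.
Unset Printing Implicit Defensive.

Local Open Scope classical_set_scope.
Local Open Scope card_scope.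

(* MathComp's {perm T} is restricted to finite T. *)
Record permutation (T : Type) := Permutation {
  permf :> T -> T;
  permfV : T -> T;
  permfK : cancel permf permfV;
  permfVK : cancel permfV permf }.

Lemma permutationP (T : Type) (f g : permutation T) : f =1 g -> f = g.
Proof.
case: f g => f f' fK f'K [g g' gK g'K] /= /funext fg; subst g.
have fg' : f' = g' by apply/funext => x; rewrite -{1}(g'K x) fK.
by subst g'; congr Permutation; exact: Prop_irrelevance.
Qed.

Section PermutationGroup.
Variable T : Type.
Implicit Types f g : permutation T.

Definition perm_id : permutation T :=
  @Permutation T id id (fun=> erefl) (fun=> erefl).
Definition perm_inv f : permutation T := Permutation (permfVK f) (permfK f).
Definition perm_mul f g : permutation T :=
  Permutation (can_comp (permfK f) (permfK g))
              (can_comp (permfVK g) (permfVK f)).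

HB.instance Definition _ := gen_eqMixin (permutation T).
HB.instance Definition _ := gen_choiceMixin (permutation T).

Fact perm_mulA : associative perm_mul.
Proof. by move=> f g h; exact: permutationP. Qed.
Fact perm_mul1g : left_id perm_id perm_mul.
Proof. by move=> f; exact: permutationP. Qed.
Fact perm_mulg1 : right_id perm_id perm_mul.
Proof. by move=> f; exact: permutationP. Qed.
Fact perm_mulVg : left_inverse perm_id perm_inv perm_mul.
Proof. by move=> f; apply: permutationP => x /=; rewrite permfK. Qed.
Fact perm_mulgV : right_inverse perm_id perm_inv perm_mul.
Proof. by move=> f; apply: permutationP => x /=; rewrite permfVK. Qed.

HB.instance Definition _ := isGroup.Build (permutation T)
  perm_mulA perm_mul1g perm_mulg1 perm_mulVg perm_mulgV.

End PermutationGroup.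

Record graph := Graph {
  gvertex :> Type;
  gadj : gvertex -> gvertex -> Prop;
  gadj_sym : forall x y, gadj x y -> gadj y x;
  gadj_irr : forall x, ~ gadj x x }.

Definition graph_automorphism (G : graph) (f : permutation G) : Prop :=
  forall x y, gadj (f x) (f y) <-> gadj x y.

Section GraphAut.
Variable G : graph.

Fact graph_automorphism_closed :
  group_closed [pred f : permutation G | `[< graph_automorphism f >]].
Proof.
split=> [|f g /asboolP fP /asboolP gP]; apply/asboolP => x y //.
by rewrite (fP (permfV g x) (permfV g y)) -gP !permfVK.
Qed.

Definition graph_aut : Type :=
  {f : permutation G | `[< graph_automorphism f >]}.
HB.instance Definition _ := SubChoice.on graph_aut.
HB.instance Definition _ :=
  SubChoice_isSubGroup.Build _ _ graph_aut graph_automorphism_closed.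

End GraphAut.

(* A graph is a cone when it is the join of some (possibly empty) graph and
   a single vertex c. *)
Definition is_cone (G : graph) : Prop :=
  exists c : G, forall x : G, x <> c -> gadj c x.

(* A complex is recorded by the vertex sets of its cubes, faces included; the
   axioms are stated separately in [cubical_complex], so that hyperplanes can
   be given their induced cubes without any side condition. *)
Record cube_system := CubeSystem {
  vertex :> Type;
  cube : set (set vertex) }.

Section CubeSystem.
Variable X : cube_system.
Implicit Types (v x y z t : X) (C D e : set X).

(* The face of [0,1]^n on which the coordinates i with s i = Some b have been
   set to b. *)
Definition cube_face (n : nat) (s : 'I_n -> option bool) :
    set {ffun 'I_n -> bool} :=
  [set a | forall i b, s i = Some b -> a i = b].

(* phi identifies the vertices of [0,1]^n with C so that the faces of [0,1]^n
   are exactly the cubes of X contained in C. *)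
Definition cube_chart (n : nat) (phi : {ffun 'I_n -> bool} -> X) C : Prop :=
  [/\ injective phi, range phi = C &
      forall D, D `<=` C ->
        (cube D <-> exists s : 'I_n -> option bool, D = phi @` cube_face s)].

(* Cubical complexes in the sense of Bridson-Haefliger, I.7.32: cubes are
   embedded and two cubes are either disjoint or meet in a common face. *)
Definition cubical_complex : Prop :=
  [/\ forall v, cube [set v],
      forall C, cube C -> exists n (phi : {ffun 'I_n -> bool} -> X),
        cube_chart phi C &
      forall C D, cube C -> cube D -> C `&` D !=set0 -> cube (C `&` D)].

Definition adjacent x y : Prop := x <> y /\ cube [set x; y].

Definition is_edge e : Prop := exists x y, adjacent x y /\ e = [set x; y].

Definition is_square C : Prop := cube C /\ C #= `I_4.

Definition span_square e e' : Prop :=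
  exists C, [/\ is_square C, e `<=` C & e' `<=` C].

Lemma span_square_sym e e' : span_square e e' -> span_square e' e.
Proof. by move=> [C [? ? ?]]; exists C. Qed.

Definition link_adjacent v (e e' : {e : set X | is_edge e /\ e v}) : Prop :=
  e <> e' /\ span_square (sval e) (sval e').

Fact link_adjacent_sym v (e e' : {e : set X | is_edge e /\ e v}) :
  link_adjacent e e' -> link_adjacent e' e.
Proof. by move=> [ne /span_square_sym sq]; split=> // /esym. Qed.

Fact link_adjacent_irr v (e : {e : set X | is_edge e /\ e v}) :
  ~ link_adjacent e e.
Proof. by case. Qed.

Definition link v : graph :=
  Graph (@link_adjacent_sym v) (@link_adjacent_irr v).

Definition extremal v : Prop := is_cone (link v).

(* The simplices of the link of v are the corners at v of the cubes
   containing v; the empty set is the corner of the cube {v}. *)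
Definition link_simplex v (S : set (link v)) : Prop :=
  exists C, [/\ cube C, C v & S = [set e | sval e `<=` C]].

Definition flag_link v : Prop :=
  forall S : set (link v), finite_set S ->
    (forall e e' : link v, S e -> S e' -> e <> e' -> gadj e e') ->
    link_simplex S.

Definition edge_path x (p : seq X) : Prop :=
  path (fun a b => `[< adjacent a b >]) x p.

Definition path_connected : Prop :=
  (exists v : X, True) /\
  forall x y, exists p, edge_path x p /\ last x p = y.

(* Two edge paths with the same endpoints are homotopic in the 2-skeleton
   when they are related by a sequence of the following moves and of their
   inverses: removing a backtrack, and replacing two consecutive sides of a
   square by the two other sides. *)
Inductive elementary_homotopy : seq X -> seq X -> Prop :=
| homotopy_backtrack p q x y of adjacent x y :
    elementary_homotopy (p ++ [:: x, y, x & q]) (p ++ [:: x & q])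
| homotopy_square p q x y z t of
    is_square [set w | [\/ w = x, w = y, w = z | w = t]]
    & adjacent x y & adjacent y z & adjacent z t & adjacent t x :
    elementary_homotopy (p ++ [:: x, y, z & q]) (p ++ [:: x, t, z & q]).

Definition homotopic : seq X -> seq X -> Prop :=
  clos_refl_sym_trans (seq X) elementary_homotopy.

Definition simply_connected : Prop :=
  path_connected /\
  forall x p, edge_path x p -> last x p = x -> homotopic (x :: p) [:: x].

(* The combinatorial form of the CAT(0) condition (Gromov). *)
Definition CAT0_cube_complex : Prop :=
  [/\ cubical_complex, simply_connected & forall v, flag_link v].

Definition uniformly_locally_finite : Prop :=
  exists N : nat, forall v, [set: link v] #<= `I_N.

Definition cubical_automorphism (f : permutation X) : Prop :=
  forall C, cube (f @` C) <-> cube C.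

Definition opposite_edges e e' : Prop :=
  [/\ is_edge e, is_edge e', span_square e e' & e `&` e' = set0].

Definition parallel : set X -> set X -> Prop :=
  clos_refl_sym_trans (set X) opposite_edges.

(* A hyperplane is recorded by the set of the edges that cross it. *)
Definition is_hyperplane (W : set (set X)) : Prop :=
  exists e, is_edge e /\ W = [set e' | parallel e e'].

Definition hyperplane : Type := {W : set (set X) | is_hyperplane W}.

Lemma hyperplane_eq (u w : hyperplane) : sval u = sval w -> u = w.
Proof. exact/eq_sig_hprop/(fun=> @Prop_irrelevance _). Qed.

(* Adjacent vertices joined by an edge that does not cross m; the equivalence
   classes generated by this relation are the vertex sets of the connected
   components of the complement of m. *)
Definition adjacent_off (m : hyperplane) x y : Prop :=
  adjacent x y /\ ~ sval m [set x; y].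

Definition same_side (m : hyperplane) : X -> X -> Prop :=
  clos_refl_sym_trans X (adjacent_off m).

(* The hyperplanes u and w lie in different components of the complement
   of m. *)
Definition separates (m u w : hyperplane) : Prop :=
  forall e e' x y, sval u e -> sval w e' -> e x -> e' y -> ~ same_side m x y.

Lemma separates_sym m u w : separates m u w -> separates m w u.
Proof.
move=> s e e' x y we ue' ex e'y xy.
exact: s ue' we e'y ex (rst_sym _ _ _ _ xy).
Qed.

Definition contact_adjacent (u w : hyperplane) : Prop :=
  u <> w /\ ~ exists m, [/\ m <> u, m <> w & separates m u w].

Fact contact_adjacent_sym u w : contact_adjacent u w -> contact_adjacent w u.
Proof.
move=> [uw ns]; split=> [/esym //|[m [mw mu /separates_sym s]]].
by apply: ns; exists m.
Qed.

Fact contact_adjacent_irr u : ~ contact_adjacent u u.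
Proof. by case. Qed.

Definition contact_graph : graph :=
  Graph contact_adjacent_sym contact_adjacent_irr.

(* The vertices of w are the midpoints of the edges crossing w, and its cubes
   are the nonempty intersections of w with the cubes of X. *)
Definition hyperplane_complex (w : hyperplane) : cube_system :=
  @CubeSystem {e : set X | sval w e}
    [set E | E !=set0 /\ exists2 C, cube C & E = [set e | sval e `<=` C]].

End CubeSystem.

Section CubicalAut.
Variable X : cube_system.

Fact cubical_automorphism_closed :
  group_closed [pred f : permutation X | `[< cubical_automorphism f >]].
Proof.
have imK (f : permutation X) C : f @` (permfV f @` C) = C.
  by rewrite image_comp (_ : _ \o _ = id) ?image_id//; apply/funext/permfVK.
split=> [|f g /asboolP fP /asboolP gP]; apply/asboolP => C.
  by rewrite image_id.
rewrite (_ : _ @` C = f @` (permfV g @` C)); last by rewrite image_comp.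
by rewrite fP -gP imK.
Qed.

Definition cube_aut : Type :=
  {f : permutation X | `[< cubical_automorphism f >]}.
HB.instance Definition _ := SubChoice.on cube_aut.
HB.instance Definition _ :=
  SubChoice_isSubGroup.Build _ _ cube_aut cubical_automorphism_closed.

Implicit Types (g : cube_aut) (e : set X) (W : set (set X)).

Fact cube_autP g : cubical_automorphism (val g).
Proof. exact/asboolP/(valP g). Qed.

Fact cube_aut_imK g e : val g^-1%g @` (val g @` e) = e.
Proof.
rewrite image_comp (_ : _ \o _ = id) ?image_id//; apply/funext => x /=.
exact: permfK.
Qed.

Fact cube_aut_imVK g e : val g @` (val g^-1%g @` e) = e.
Proof.
rewrite image_comp (_ : _ \o _ = id) ?image_id//; apply/funext => x /=.
exact: permfVK.
Qed.

Fact cube_aut_adjacent g (x y : X) :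
  adjacent x y -> adjacent (val g x) (val g y).
Proof.
move=> [xy c]; split.
  by move=> gxy; apply: xy; exact: (can_inj (permfK (val g)) gxy).
by have := cube_autP g [set x; y]; rewrite image_setU !image_set1 => ->.
Qed.

Fact cube_aut_edge g e : is_edge e -> is_edge (val g @` e).
Proof.
move=> [x [y [xy ->]]]; exists (val g x), (val g y).
by split; [exact: cube_aut_adjacent | rewrite image_setU !image_set1].
Qed.

Fact cube_aut_square g C : is_square C -> is_square (val g @` C).
Proof.
move=> [cC C4]; split; first exact/cube_autP.
apply: card_eq_trans C4; apply: inj_card_eq => x y _ _.
exact: (can_inj (permfK (val g))).
Qed.

Fact cube_aut_opposite g e e' :
  opposite_edges e e' -> opposite_edges (val g @` e) (val g @` e').
Proof.
move=> [ee ee' [C [sC eC e'C]] d]; split; do ?exact: cube_aut_edge.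
  exists (val g @` C); split; [exact: cube_aut_square|exact: image_subset..].
apply/seteqP; split=> // z [[x ex <-] [y e'y]] /(can_inj (permfK (val g))) yx.
have : (e `&` e') x by split; rewrite // -yx.
by rewrite d.
Qed.

Fact cube_aut_parallel g e e' :
  parallel e e' -> parallel (val g @` e) (val g @` e').
Proof.
elim=> [a b ab|a|a b _ ab|a b c _ ab _ bc].
- exact/rst_step/cube_aut_opposite.
- exact: rst_refl.
- exact: rst_sym.
- exact: rst_trans ab bc.
Qed.

Fact cube_aut_hyperplane g W :
  is_hyperplane W -> is_hyperplane [set val g @` e | e in W].
Proof.
move=> [e [ee ->]]; exists (val g @` e); split; first exact: cube_aut_edge.
apply/seteqP; split=> [_ [a ea <-]|b gb]; first exact: cube_aut_parallel.
exists (val g^-1%g @` b); last exact: cube_aut_imVK.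
by rewrite /= -(cube_aut_imK g e); exact: cube_aut_parallel.
Qed.

(* The image of a hyperplane: an edge e crosses w iff its image g e
   crosses g w. *)
Definition hyperplane_image g (w : hyperplane X) : hyperplane X :=
  exist _ [set val g @` e | e in sval w] (cube_aut_hyperplane g (svalP w)).

Fact hyperplane_imageK g :
  cancel (hyperplane_image g) (hyperplane_image g^-1%g).
Proof.
move=> w; apply: hyperplane_eq => /=; apply/seteqP; split.
  by move=> _ [_ [e we <-] <-]; rewrite cube_aut_imK.
move=> e we; exists (val g @` e); last exact: cube_aut_imK.
by exists e.
Qed.

Fact hyperplane_imageVK g :
  cancel (hyperplane_image g^-1%g) (hyperplane_image g).
Proof. by move=> w; rewrite -{1}(invgK g) hyperplane_imageK. Qed.

Definition hyperplane_perm g : permutation (contact_graph X) :=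
  @Permutation (contact_graph X) _ _
    (hyperplane_imageK g) (hyperplane_imageVK g).

Fact cube_aut_same_side g (m : hyperplane X) x y :
  same_side m x y -> same_side (hyperplane_image g m) (val g x) (val g y).
Proof.
elim=> [a b [ab nm]|a|a b _ ab|a b c _ ab _ bc].
- apply: rst_step; split; first exact: cube_aut_adjacent.
  move=> [e me]; rewrite -(image_set1 _ a) -(image_set1 _ b) -image_setU => eq.
  by apply: nm; rewrite -(cube_aut_imK g [set a; b]) -eq cube_aut_imK.
- exact: rst_refl.
- exact: rst_sym.
- exact: rst_trans ab bc.
Qed.

Fact cube_aut_separates g (m u w : hyperplane X) :
  separates m u w -> separates (hyperplane_image g m)
                       (hyperplane_image g u) (hyperplane_image g w).
Proof.
move=> s _ _ _ _ [e ue <-] [e' we' <-] [x ex <-] [y e'y <-].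
move=> /(cube_aut_same_side g^-1%g); rewrite hyperplane_imageK.
by rewrite /= !permfK; exact: s ue we' ex e'y.
Qed.

Fact hyperplane_perm_contact g : graph_automorphism (hyperplane_perm g).
Proof.
have imp h (u w : hyperplane X) : contact_adjacent u w ->
    contact_adjacent (hyperplane_image h u) (hyperplane_image h w).
  move=> [uw ns]; split.
    by move=> huw; apply: uw; exact: (can_inj (hyperplane_imageK h) huw).
  move=> [m [mu mw s]]; apply: ns; exists (hyperplane_image h^-1%g m); split.
  - by move=> mE; apply: mu; rewrite -mE hyperplane_imageVK.
  - by move=> mE; apply: mw; rewrite -mE hyperplane_imageVK.
  - by move: (@cube_aut_separates h^-1%g _ _ _ s); rewrite !hyperplane_imageK.
move=> u w; split=> [/(imp g^-1%g)|]; last exact: imp.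
by rewrite /= !hyperplane_imageK.
Qed.

(* The natural homomorphism from Aut X to Aut C(X). *)
Definition contact_action g : graph_aut (contact_graph X) :=
  exist _ (hyperplane_perm g) (asboolT (hyperplane_perm_contact g)).

Fact contact_action_mul : {morph contact_action : g h / (g * h)%g}.
Proof.
move=> g h; apply/val_inj/permutationP => w.
apply: hyperplane_eq => /=; apply/seteqP.
split=> [_ [e we <-]|_ [_ [e we <-] <-]].
  exists (val h @` e); first by exists e.
  by rewrite image_comp.
by exists e; rewrite // image_comp.
Qed.

HB.instance Definition _ :=
  isMultiplicative.Build cube_aut (graph_aut (contact_graph X))
    contact_action contact_action_mul.

End CubicalAut.

(* Main.v *)
(* Let star v be the set of hyperplanes crossing an edge at v, equivalently of
   those whose carrier contains v. By the Helly property of carriers every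
   finite clique of the contact graph lies in some star v. If star v is
   contained in star w with v <> w, the hyperplane crossing the first edge of a
   geodesic from v to w is transverse at v to every other hyperplane of star v,
   so that v is extremal. Hence the stars are exactly the maximal cliques, an
   automorphism of the contact graph permutes them, and this defines rho.

   When no hyperplane has extremal vertices, distinct v and w are adjacent iff
   star v /\ star w is contained in no other star, so that rho takes values in
   Aut X; and a hyperplane is determined by its carrier, whence iota o rho = id.

   The underlying geometry is that of median graphs. Square moves and backtrack
   removals let the edge paths act on the reduced walks modulo square moves (the
   device van der Waerden used for free products). Homotopic paths act equally,
   so by simple connectivity geodesics with common endpoints differ by square
   moves; this is the quadrangle condition, from which medians, the convexity
   of carriers and the separation of disjoint convex sets follow. *)

From HB Require Import structures.
Require Import Defs.
From mathcomp Require Import zify.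

Set Implicit Arguments.
Unset Strict Implicit.
Unset Printing Implicit Defensive.

Local Open Scope classical_set_scope.
Local Open Scope card_scope.

(** * Cubes and squares *)

Lemma card_set_seq (T : choiceType) (s : seq T) :
  uniq s -> [set` s] #= `I_(size s).
Proof.
move=> us; have [->|] := eqVneq s [::]; first by rewrite set_nil II0.
case: {1}s => // x0 _ _.
have -> : [set` s] = nth x0 s @` `I_(size s).
  apply/seteqP; split=> x /=.
    by move=> xs; exists (index x s); rewrite ?nth_index //= index_mem.
  by move=> [i ilt <-]; exact: mem_nth.
apply: inj_card_eq => i j; rewrite !inE /= => il jl /eqP.
by rewrite nth_uniq // => /eqP.
Qed.

Lemma card_leq_seq (T : choiceType) (s : seq T) n (A : set T) :
  uniq s -> [set` s] `<=` A -> A #<= `I_n -> size s <= n.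
Proof.
move=> us sA An; rewrite -card_le_II; apply: card_le_trans An.
apply: card_le_trans (subset_card_le sA); have := card_set_seq us.
by rewrite card_eq_le => /andP[].
Qed.

Lemma card_eq_seq (T : choiceType) (s : seq T) (A : set T) :
  uniq s -> [set` s] `<=` A -> A #= `I_(size s) -> A = [set` s].
Proof.
move=> us sA; rewrite card_eq_le => /andP[An _].
apply/seteqP; split=> // x Ax /=; apply: contrapT => /negP xs.
suff : size (x :: s) <= size s by rewrite /= ltnn.
apply: card_leq_seq An; first by rewrite /= xs.
by move=> y /=; rewrite inE => /orP[/eqP->|/sA].
Qed.

Definition set4 (T : Type) (x y z t : T) : set T :=
  [set w | [\/ w = x, w = y, w = z | w = t]].

Lemma set4E (T : choiceType) (x y z t : T) :
  set4 x y z t = [set` [:: x; y; z; t]].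
Proof.
apply/seteqP; split=> w /=; rewrite !inE.
  by move=> [] ->; rewrite eqxx ?orbT.
by move=> /or4P[] /eqP ->; [constructor 1|constructor 2|constructor 3|constructor 4].
Qed.

Lemma uniq4 (T : choiceType) (x y z t : T) :
  x <> y -> x <> z -> x <> t -> y <> z -> y <> t -> z <> t ->
  uniq [:: x; y; z; t].
Proof.
have nE (u v : T) : u <> v -> (u == v) = false by move=> /eqP/negbTE.
by move=> *; rewrite /= !inE !nE.
Qed.

Lemma card_set4 (T : Type) (x y z t : T) :
  x <> y -> x <> z -> x <> t -> y <> z -> y <> t -> z <> t ->
  set4 x y z t #= `I_4.
Proof.
move=> xy xz xt yz yt zt; rewrite (@set4E {classic T}).
apply: (@card_set_seq {classic T} [:: x; y; z; t]); exact: (@uniq4 {classic T}).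
Qed.

Lemma set4_diag_neq (T : choiceType) (x y z t : T) : set4 x y z t #= `I_4 ->
  x <> z /\ y <> t.
Proof.
rewrite set4E card_eq_le => /andP[_ le4].
have small (s : seq T) : size s < 4 -> {subset [:: x; y; z; t] <= s} -> False.
  move=> s3 sub; suff : 4 <= size s by rewrite leqNgt s3.
  rewrite -card_le_II; apply: (card_le_trans le4).
  apply: (card_le_trans (B := [set` undup s])).
    by apply: subset_card_le => w /= ws; rewrite mem_undup; exact: sub.
  have := card_set_seq (undup_uniq s); rewrite card_eq_le => /andP[h _].
  by apply: card_le_trans h _; rewrite card_le_II size_undup.
split=> E; subst.
  apply: (small [:: z; y; t]) => // w; rewrite !inE.
  by case: (w == z); case: (w == y).
apply: (small [:: x; z; t]) => // w; rewrite !inE.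
by case: (w == x); case: (w == z); case: (w == t).
Qed.

Lemma set4_distinct (T : Type) (x y z t : T) : set4 x y z t #= `I_4 ->
  x <> z /\ y <> t.
Proof. exact: (@set4_diag_neq {classic T}). Qed.

Section Cubes.
Variable X : cube_system.
Implicit Types (x y z v a b c : X) (C D : set X).

(* The vertices are listed in cyclic order. *)
Definition sq (x y z t : X) := [/\ is_square (set4 x y z t),
  adjacent x y, adjacent y z, adjacent z t & adjacent t x].

Lemma adjacentC x y : adjacent x y -> adjacent y x.
Proof. by move=> [xy c]; split; [move/esym|rewrite setUC]. Qed.

Lemma set4_rot (T : Type) (x y z t : T) : set4 x y z t = set4 y z t x.
Proof.
by apply/seteqP; split=> w [] ->; do ?[by constructor 1|by constructor 2|
  by constructor 3|by constructor 4].
Qed.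

Lemma set4_rev (T : Type) (x y z t : T) : set4 x y z t = set4 x t z y.
Proof.
by apply/seteqP; split=> w [] ->; do ?[by constructor 1|by constructor 2|
  by constructor 3|by constructor 4].
Qed.

Lemma sq_rot x y z t : sq x y z t -> sq y z t x.
Proof. by rewrite /sq set4_rot => -[]. Qed.

Lemma sq_rev x y z t : sq x y z t -> sq x t z y.
Proof.
by rewrite /sq set4_rev => -[? /adjacentC ? /adjacentC ? /adjacentC ? /adjacentC ?].
Qed.

Lemma sq_diag x y z t : sq x y z t -> x <> z /\ y <> t.
Proof. by move=> [[_ card4] _ _ _ _]; exact: set4_distinct card4. Qed.

(** * Coordinates on a cube and the faces of its charts *)

Definition flip n (i : 'I_n) (s : {ffun 'I_n -> bool}) : {ffun 'I_n -> bool} :=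
  [ffun j => s j (+) (j == i)].

Lemma flipK n (i : 'I_n) : involutive (flip i).
Proof. by move=> s; apply/ffunP => j; rewrite !ffunE addbK. Qed.

Lemma flipC n (i j : 'I_n) s : flip i (flip j s) = flip j (flip i s).
Proof. by apply/ffunP => k; rewrite !ffunE addbAC. Qed.

Lemma flip_neq n (i : 'I_n) s : flip i s <> s.
Proof. by move=> /ffunP E; move: (E i); rewrite ffunE eqxx; case: (s i). Qed.

Lemma flip_inj n (i j : 'I_n) s : flip i s = flip j s -> i = j.
Proof.
move=> /ffunP E; move: (E i); rewrite !ffunE eqxx.
by case: eqP => // _; case: (s i).
Qed.

Lemma flip2_neq n (i j : 'I_n) s : i <> j -> flip i (flip j s) <> s.
Proof.
by move=> ij E; apply/ij/(@flip_inj _ _ _ s); rewrite -{2}E flipC flipK.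
Qed.

Definition subface n (A : pred 'I_n) (s : {ffun 'I_n -> bool}) (j : 'I_n) :=
  if A j then None else Some (s j).

Lemma cube_face_subface n (A : pred 'I_n) (s u : {ffun 'I_n -> bool}) :
  cube_face (subface A s) u <-> forall j, ~~ A j -> u j = s j.
Proof.
split=> [h j nA|h j b]; first by apply: h; rewrite /subface (negbTE nA).
by rewrite /subface; case: ifPn => // nA [<-]; exact: h.
Qed.

Section Chart.
Variables (n : nat) (phi : {ffun 'I_n -> bool} -> X) (C : set X).
Hypothesis chart : cube_chart phi C.

Let phi_inj : injective phi. Proof. by case: chart. Qed.

Lemma chart_in s : C (phi s).
Proof. by case: chart => _ <- _; exists s. Qed.

Lemma chart_onto x : C x -> exists s, x = phi s.
Proof. by case: chart => _ <- _ [s _ <-]; exists s. Qed.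

Lemma chart_face (S : 'I_n -> option bool) : cube (phi @` cube_face S).
Proof.
case: chart => _ _ /(_ (phi @` cube_face S)) h; apply/h; last by exists S.
by move=> _ [s _ <-]; exact: chart_in.
Qed.

Lemma chart_subcube D : D `<=` C -> cube D -> exists S, D = phi @` cube_face S.
Proof. by case: chart => _ _ h DC; move/(h _ DC). Qed.

(** An edge inside [C] is a face with two vertices. A coordinate on which its ends differ is free in
    that face, so flipping it at [s] stays in the face and can only give the other end. *)
Lemma chart_adj (s t : {ffun 'I_n -> bool}) :
  adjacent (phi s) (phi t) <-> exists i, t = flip i s.
Proof.
split=> [[st]|[i ->]].
  have sub : [set phi s; phi t] `<=` C by move=> _ [->|->]; exact: chart_in.
  move=> /(chart_subcube sub)[S E].
  have /existsP[i /eqP sti] : [exists i, s i != t i].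
    apply: contrapT => /negP/existsPn h; apply: st; congr phi.
    by apply/ffunP => i; apply/eqP; rewrite -[_ == _]negbK h.
  have inS u : [set phi s; phi t] (phi u) <-> cube_face S u.
    rewrite E; split=> [[w Sw /phi_inj <-//]|Su]; by exists u.
  have Ss : cube_face S s by apply/inS; left.
  have St : cube_face S t by apply/inS; right.
  have [/phi_inj|/phi_inj] : [set phi s; phi t] (phi (flip i s)).
  - apply/inS => j b Sj; rewrite ffunE; case: eqP => [ji|_]; last first.
      by rewrite addbF; exact: Ss.
    by case: sti; rewrite -ji (Ss _ _ Sj) (St _ _ Sj).
  - by move=> /flip_neq.
  - by move=> <-; exists i.
split; first by move/phi_inj/esym/flip_neq.
rewrite (_ : [set _; _] = phi @` cube_face (subface (pred1 i) s)).
  exact: chart_face.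
apply/seteqP; split=> [_ [->|->]|_ [u /cube_face_subface hu <-]].
- by exists s => //; apply/cube_face_subface.
- exists (flip i s) => //; apply/cube_face_subface => j /= /negbTE ji.
  by rewrite ffunE ji addbF.
- have [E|E] := eqVneq (u i) (s i); [left|right]; congr phi; apply/ffunP => j.
    by have [->|/hu] := eqVneq j i.
  rewrite ffunE; have [->|ji] := eqVneq j i; last by rewrite addbF hu.
  by rewrite addbT; move: E; case: (u i); case: (s i).
Qed.

Lemma chart_sq i j s : i <> j ->
  sq (phi s) (phi (flip i s)) (phi (flip i (flip j s))) (phi (flip j s)).
Proof.
move=> ij; split; last first.
- by apply/chart_adj; exists j; rewrite flipK.
- by apply/chart_adj; exists i; rewrite flipK.
- by apply/chart_adj; exists j; rewrite flipC.
- by apply/chart_adj; exists i.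
split; last first.
  apply: card_set4 => /phi_inj.
  - by move=> /esym/flip_neq.
  - by move=> /esym/flip2_neq.
  - by move=> /esym/flip_neq.
  - by rewrite flipC => /esym/flip_neq.
  - by move=> /flip_inj.
  - exact: flip_neq.
rewrite (_ : set4 _ _ _ _ = phi @` cube_face (subface (pred2 i j) s)).
  exact: chart_face.
have ij' : (i == j) = false by apply/eqP.
have ji' : (j == i) = false by rewrite eq_sym.
apply/seteqP; split=> [_ [|||] ->|_ [t /cube_face_subface ht <-]].
- by exists s => //; apply/cube_face_subface.
- exists (flip i s) => //; apply/cube_face_subface => k /=.
  by rewrite negb_or ffunE => /andP[/negbTE-> _]; rewrite addbF.
- exists (flip i (flip j s)) => //; apply/cube_face_subface => k /=.
  by rewrite negb_or !ffunE => /andP[/negbTE-> /negbTE->]; rewrite !addbF.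
- exists (flip j s) => //; apply/cube_face_subface => k /=.
  by rewrite negb_or ffunE => /andP[_ /negbTE->]; rewrite addbF.
have tE (u : {ffun _ -> bool}) : t i = u i -> t j = u j ->
    (forall k, k != i -> k != j -> u k = s k) ->
    t = u.
  move=> ti tj h; apply/ffunP => k.
  have [->//|ki] := eqVneq k i; have [->//|kj] := eqVneq k j.
  by rewrite ht ?h //= negb_or ki.
rewrite /set4 /=.
have [Ei|Ei] := eqVneq (t i) (s i); have [Ej|Ej] := eqVneq (t j) (s j).
- by constructor 1; congr phi; apply: tE.
- constructor 4; congr phi; apply: tE.
  + by rewrite ffunE ij' addbF.
  + by rewrite ffunE eqxx addbT; move: Ej; case: (t j); case: (s j).
  + by move=> k _ /negbTE kj; rewrite ffunE kj addbF.
- constructor 2; congr phi; apply: tE.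
  + by rewrite ffunE eqxx addbT; move: Ei; case: (t i); case: (s i).
  + by rewrite ffunE ji' addbF.
  + by move=> k /negbTE ki _; rewrite ffunE ki addbF.
- constructor 3; congr phi; apply: tE.
  + by rewrite !ffunE eqxx ij' addbT addbF; move: Ei; case: (t i); case: (s i).
  + by rewrite !ffunE eqxx ji' addbT addbF; move: Ej; case: (t j); case: (s j).
  + by move=> k /negbTE ki /negbTE kj; rewrite !ffunE ki kj !addbF.
Qed.

End Chart.

Hypothesis X_cubical : cubical_complex X.

Lemma cube_chartP C : cube C ->
  exists n (phi : {ffun 'I_n -> bool} -> X), cube_chart phi C.
Proof. by case: X_cubical => _ h _; exact: h. Qed.

(** The intersection of [D] with the square is a face of the square. Containing [y] and both of its
    neighbours there, it leaves both coordinates free, so it is the whole square. *)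
Lemma cube_square_closed D y a z b :
  cube D -> D y -> D a -> D b -> sq y a z b -> D z.
Proof.
move=> cD Dy Da Db sqy; have [[cC cardC] ya az zb bY] := sqy.
have [/= yz ab] := sq_diag sqy.
have [n [phi chart]] := cube_chartP cC.
have phi_inj : injective phi by case: chart.
have [s ys] : exists s, y = phi s by apply: (chart_onto chart); constructor 1.
have [sa as_] : exists s, a = phi s by apply: (chart_onto chart); constructor 2.
have [sb bs] : exists s, b = phi s by apply: (chart_onto chart); constructor 4.
move: ya; rewrite ys as_ => /(chart_adj chart)[i si].
move: bY; rewrite ys bs => /adjacentC /(chart_adj chart)[j sj].
have ij : i <> j by move=> ij; apply: ab; rewrite as_ bs si sj ij.
have zE : z = phi (flip i (flip j s)).
  have : set4 y a z b (phi (flip i (flip j s))) by exact: (chart_in chart).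
  rewrite ys as_ bs si sj => -[] // /phi_inj.
  - by move/(flip2_neq ij).
  - by rewrite flipC => /flip_neq.
  - by move/flip_neq.
have [S SE] : exists S, set4 y a z b `&` D = phi @` cube_face S.
  apply: (chart_subcube chart); first by apply: subIsetl.
  have [_ _ h] := X_cubical; apply: h => //.
  by exists y; split=> //; constructor 1.
have inS u : D (phi u) -> cube_face S u.
  move=> Du; have : (phi @` cube_face S) (phi u).
    by rewrite -SE; split=> //; exact: (chart_in chart).
  by move=> [w Sw /phi_inj <-].
have Ss : cube_face S s by apply: inS; rewrite -ys.
have Sa : cube_face S sa by apply: inS; rewrite -as_.
have Sb : cube_face S sb by apply: inS; rewrite -bs.
suff : (set4 y a z b `&` D) z by case.
rewrite SE zE; exists (flip i (flip j s)) => // k b' Sk.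
have sk := Ss _ _ Sk; have := Sa _ _ Sk; have := Sb _ _ Sk.
rewrite si sj !ffunE sk.
by case: (k == i); case: (k == j); case: b' {Sk sk}.
Qed.

(** By [cube_square_closed] the second square contains [z], which differs from its other three
    corners. *)
Lemma sq_uniq y a z z' b : sq y a z b -> sq y a z' b -> z = z'.
Proof.
move=> sqz sqz'; have [[cC' _] _ _ _ _] := sqz'.
have [yz _] := sq_diag sqz; have [_ _ [za _] [zb _] _] := sqz.
have [zy|za'|//|zb'] : set4 y a z' b z.
- apply: (@cube_square_closed (set4 y a z' b) y a z b) => //;
    by [constructor 1|constructor 2|constructor 4].
- by case: yz.
- by case: za.
- by case: zb.
Qed.

Lemma chart_square n (phi : {ffun 'I_n -> bool} -> X) D y a z b :
  cube_chart phi D -> cube D -> D y -> D a -> D b -> sq y a z b ->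
  exists s i j, [/\ i <> j, y = phi s, a = phi (flip i s),
    b = phi (flip j s) & z = phi (flip i (flip j s))].
Proof.
move=> chart cD /(chart_onto chart)[s ->] /(chart_onto chart)[sa ->].
move=> /(chart_onto chart)[sb ->] sqy.
have [_ /(chart_adj chart)[i si] _ _ /adjacentC/(chart_adj chart)[j sj]] := sqy.
have [_ ab] := sq_diag sqy.
have ij : i <> j by move=> ij; apply: ab; rewrite si sj ij.
exists s, i, j; rewrite -si -sj; split=> //.
by move: sqy; rewrite si sj => /sq_uniq; apply; exact: (chart_sq chart).
Qed.

Lemma span_squareP v a b : adjacent v a -> adjacent v b -> a <> b ->
  span_square [set v; a] [set v; b] <-> exists z, sq v a z b.
Proof.
move=> va vb ab; split=> [[C [[cC _] aC bC]]|[z [sq4 _ _ _ _]]]; last first.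
  exists (set4 v a z b); split=> // w [->|->].
  - by constructor 1. - by constructor 2. - by constructor 1. - by constructor 4.
have [n [phi chart]] := cube_chartP cC.
have /(chart_onto chart)[s vs] : C v by apply: aC; left.
have /(chart_onto chart)[sa as_] : C a by apply: aC; right.
have /(chart_onto chart)[sb bs] : C b by apply: bC; right.
move: va vb; rewrite vs as_ bs => /(chart_adj chart)[i si] /(chart_adj chart)[j sj].
exists (phi (flip i (flip j s))); rewrite si sj; apply: (chart_sq chart) => ij.
by apply: ab; rewrite as_ bs si sj ij.
Qed.

Lemma sq_opposite a b c d : sq a b c d -> opposite_edges [set a; b] [set d; c].
Proof.
move=> sqa; have [ac bd] := sq_diag sqa; have [sq4 ab bc cd da] := sqa.
split; [by exists a, b|by exists d, c; split=> //; exact: adjacentC| |].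
  exists (set4 a b c d); split=> // w [->|->].
  - by constructor 1. - by constructor 2. - by constructor 4. - by constructor 3.
apply/seteqP; split=> // w [[->|->] [|]] //=.
- by case: da => da _ /esym. - by case: bc.
Qed.

(** The edges are unordered pairs, so the cyclic order of the square is determined only up to
    exchanging [c] and [d]. *)
Lemma opposite_sq a b c d : adjacent a b -> adjacent c d ->
  opposite_edges [set a; b] [set c; d] -> sq a b c d \/ sq a b d c.
Proof.
move=> ab cd [_ _ [C [[cC cardC] abC cdC]] dis].
have disN w : [set a; b] w -> [set c; d] w -> False.
  by move=> h1 h2; have : ([set a; b] `&` [set c; d]) w by []; rewrite dis.
have [n [phi chart]] := cube_chartP cC.
have phi_inj : injective phi by case: chart.
have Ca : C a by apply: abC; left.
have Cb : C b by apply: abC; right.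
have Cc : C c by apply: cdC; left.
have Cd : C d by apply: cdC; right.
have CE : C = set4 a b c d.
  rewrite (@set4E {classic X}); apply: (@card_eq_seq {classic X}) => //.
    case: ab => ab _; case: cd => cd _.
    apply: (@uniq4 {classic X}) => // E.
    + by apply: (disN a); [left|left].
    + by apply: (disN a); [left|right].
    + by apply: (disN b); [right|left].
    + by apply: (disN b); [right|right].
  by rewrite -(@set4E {classic X}) => w [] ->.
have [s as_] := chart_onto chart Ca; have [sb bs] := chart_onto chart Cb.
have [sc cs] := chart_onto chart Cc.
move: (ab); rewrite as_ bs => /(chart_adj chart)[i si].
(* If [c] agreed with [a] in every coordinate other than [i], it would be [a] or [b]. *)
have /existsP[j /andP[ji jc]] : [exists j, (j != i) && (sc j != s j)].
  apply: contrapT => /negP/existsPn h.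
  have h' j : j != i -> sc j = s j.
    by move=> ji; apply/eqP; move: (h j); rewrite ji negbK.
  have [Ei|Ei] := eqVneq (sc i) (s i).
    apply: (disN a); left=> //; rewrite as_ cs; congr phi; apply/ffunP => j.
    by have [->|/h'] := eqVneq j i.
  apply: (disN b); [by right|left]; rewrite bs si cs; congr phi; apply/ffunP => j.
  rewrite ffunE; have [->|/h'->] := eqVneq j i; last by rewrite addbF.
  by rewrite addbT; move: Ei; case: (sc i); case: (s i).
have ij : i <> j by move=> E; rewrite E eqxx in ji.
have sqa := chart_sq chart s ij.
have /[!CE] Cp := chart_in chart (flip i (flip j s)).
have /[!CE] Cq := chart_in chart (flip j s).
rewrite -si -as_ -bs in sqa.
have [pa pb] := sq_diag sqa; have [_ _ [pb' _] [pq _] [qa _]] := sqa.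
rewrite -as_ -bs; case: Cp => Ep; rewrite Ep in sqa pa pb' pq.
- by case: pa.
- by case: pb'.
- by case: Cq => Eq; rewrite Eq in sqa pb pq qa; [case: qa|case: pb|case: pq|left].
- by case: Cq => Eq; rewrite Eq in sqa pb pq qa; [case: qa|case: pb|right|case: pq].
Qed.

(** * The flag condition in terms of neighbours, and 3-cubes *)

Lemma link_vertex_eq v (e e' : link v) : sval e = sval e' -> e = e'.
Proof. exact/eq_sig_hprop/(fun=> @Prop_irrelevance _). Qed.

Hypothesis X_flag : forall v, flag_link v.

(** The flag condition with a vertex of the link replaced by the other end of its edge, and
    adjacency in the link by a square at [v]. *)
Lemma flag_cube v (A : set X) : finite_set A -> (forall a, A a -> adjacent v a) ->
  (forall a b, A a -> A b -> a <> b -> exists z, sq v a z b) ->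
  exists D, [/\ cube D, D v & forall a, adjacent v a -> (D a <-> A a)].
Proof.
move=> finA adjA sqA.
have edge a : adjacent v a -> is_edge [set v; a] /\ [set v; a] v.
  by move=> va; split; [exists v, a|left].
pose S : set (link v) := [set e | exists2 a, A a & sval e = [set v; a]].
have edge_inj a b : adjacent v a -> [set v; a] = [set v; b] -> a = b.
  move=> [va _] E; have : [set v; b] a by rewrite -E; right.
  by case=> // /esym.
have [|e e' [a Aa ea] [b Ab eb] ee'|C [cC Cv SE]] := @X_flag v S.
- have [->|/set0P[e0 _]] := eqVneq S set0; first exact: finite_set0.
  (* [f] is made total by the default value [e0] off the neighbours of [v]; [S] is finite because it
     lies in the image of [A]. *)
  pose f a : link v := if pselect (adjacent v a) is left h then exist _ _ (edge a h) else e0.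
  apply: sub_finite_set (finite_image f finA) => e [a Aa ea]; exists a => //.
  rewrite /f; case: pselect => [h|[]]; last exact: adjA.
  exact: link_vertex_eq.
- split=> //; rewrite ea eb; apply/span_squareP; do ?exact: adjA.
    by move=> ab; apply: ee'; apply: link_vertex_eq; rewrite ea eb ab.
  apply: sqA => // ab; apply: ee'; apply: link_vertex_eq; by rewrite ea eb ab.
exists C; split=> // a va; split=> [Ca|Aa].
  have : S (exist _ _ (edge a va)).
    by rewrite SE => w /= [->|->].
  by move=> [b Ab /= /(edge_inj _ _ va) ->].
have : S (exist _ _ (edge a va)) by exists a.
by rewrite SE /=; apply; right.
Qed.

(** The flag condition at [y] applied to [a], [b], [c] gives a cube, and in one chart the three
    squares become the coordinate squares in directions [i], [j], [k]. The new corner [abc] is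
    opposite to [y]. The list of all vertices of [D] serves to compute which edges of a hyperplane
    lie in it. *)
Lemma cube3 y a b c ab bc ac : sq y a ab b -> sq y b bc c -> sq y a ac c ->
  exists abc D, [/\ sq a ab abc ac, sq b ab abc bc, sq c ac abc bc, cube D &
    D = set4 y a ab b `|` set4 c ac abc bc].
Proof.
move=> sab sbc sac.
have [_ ya _ _ /adjacentC yb] := sab; have [_ _ _ _ /adjacentC yc] := sbc.
have [_ nab] := sq_diag sab; have [_ nbc] := sq_diag sbc.
have [_ nac] := sq_diag sac.
have [|||D [cD Dy DA]] := @flag_cube y [set a; b; c].
- by rewrite !finite_setU; do !split; exact: finite_set1.
- by move=> p [[->|->]|->].
- move=> p q [[->|->]|->] [[->|->]|->] // _.
  + by exists ab. + by exists ac. + by exists ab; exact: sq_rev.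
  + by exists bc. + by exists ac; exact: sq_rev. + by exists bc; exact: sq_rev.
have Da : D a by apply/DA => //; left; left.
have Db : D b by apply/DA => //; left; right.
have Dc : D c by apply/DA => //; right.
have [n [phi chart]] := cube_chartP cD.
have phi_inj : injective phi by case: chart.
have [s [i [j [ij ys as_ bs abs]]]] := chart_square chart cD Dy Da Db sab.
have [s' [j' [k [jk ys' bs' cs bcs]]]] := chart_square chart cD Dy Db Dc sbc.
have ss : s' = s by apply: phi_inj; rewrite -ys -ys'.
subst s'; have jj : j' = j by apply: (@flip_inj _ _ _ s); apply: phi_inj; rewrite -bs -bs'.
subst j'; have [s'' [i' [k' [ik ys'' as' cs' acs]]]] := chart_square chart cD Dy Da Dc sac.
have ss : s'' = s by apply: phi_inj; rewrite -ys -ys''.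
subst s''; have ii : i' = i by apply: (@flip_inj _ _ _ s); apply: phi_inj; rewrite -as_ -as'.
subst i'; have kk : k' = k by apply: (@flip_inj _ _ _ s); apply: phi_inj; rewrite -cs -cs'.
subst k'.
(* There is no fourth direction: each flip of [s] is a neighbour of [y] inside [D], hence [a], [b]
   or [c]. *)
have ijk l : [|| l == i, l == j | l == k].
  have yl : adjacent y (phi (flip l s)).
    by rewrite ys; apply/(chart_adj chart); exists l.
  have /(DA _ yl) := chart_in chart (flip l s).
  by rewrite as_ bs cs => -[[]|] /phi_inj /flip_inj ->; rewrite eqxx ?orbT.
exists (phi (flip i (flip j (flip k s)))), D; split=> //.
- rewrite abs acs as_; have := chart_sq chart (flip i s) jk.
  by rewrite (flipC k i s) (flipC j i s) (flipC j i (flip k s)).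
- rewrite abs bs bcs; have := chart_sq chart (flip j s) ik.
  by rewrite (flipC k j).
- rewrite acs bcs cs; exact: (chart_sq chart (flip k s) ij).
(* Splitting [D] along [k] into two opposite squares, each in directions [i] and [j]. *)
have bits t : exists t', [/\ t' = s \/ t' = flip k s &
   [\/ t = t', t = flip i t', t = flip j t' | t = flip i (flip j t')]].
  pose sg l := t l (+) s l.
  exists (if sg k then flip k s else s); split; first by case: (sg k); [right|left].
  have E l : t l = s l (+) sg l by rewrite /sg addbC addbK.
  have nij : (i == j) = false by apply/eqP.
  have nik : (i == k) = false by apply/eqP.
  have njk : (j == k) = false by apply/eqP.
  have h (u : {ffun 'I_n -> bool}) : t i = u i -> t j = u j -> t k = u k -> t = u.
    by move=> *; apply/ffunP => l; have /or3P[] := ijk l => /eqP ->.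
  have Ei := E i; have Ej := E j; have Ek := E k.
  by case ski: (sg i) Ei => Ei; case skj: (sg j) Ej => Ej;
  [constructor 4|constructor 2|constructor 3|constructor 1];
  case skk: (sg k) Ek => Ek; apply: h; 
  rewrite ?ffunE ?Ei ?Ej ?Ek ?(eq_sym j i) ?(eq_sym k i) ?(eq_sym k j) ?eqxx
    ?nij ?nik ?njk ?addbT ?addbF.
apply/seteqP; split=> [w /(chart_onto chart)[t ->]|w].
  have [t' [[->|->] tE]] := bits t; [left|right].
    rewrite ys as_ abs bs.
    by case: tE => ->; [constructor 1|constructor 2|constructor 4|constructor 3].
  rewrite cs acs bcs.
  by case: tE => ->; [constructor 1|constructor 2|constructor 4|constructor 3].
by move=> [[] ->|[] ->]; rewrite ?ys ?as_ ?bs ?cs ?abs ?acs ?bcs; exact: (chart_in chart).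
Qed.

End Cubes.

(** * Geodesics and square moves *)

Section Walks.
Variable X : cube_system.
Implicit Types (x y z t a b c u v w : X) (p q r s l : seq X).

(* Walks are listed from their last vertex back to the first. In swap_square the
   two walks end with opposite sides w, a, y and w, b, y of a square; stating
   the relation by recursion on the last edge makes inversion immediate and
   leaves transitivity as the only nontrivial property. *)
Inductive swap_eq : seq X -> seq X -> Prop :=
| swap_nil : swap_eq [::] [::]
| swap_cons y p q of swap_eq p q : swap_eq (y :: p) (y :: q)
| swap_square y a b w r p q of sq y a w b & swap_eq p [:: a, w & r] &
    swap_eq q [:: b, w & r] : swap_eq (y :: p) (y :: q).

Lemma swap_refl p : swap_eq p p.
Proof. by elim: p => [|x p IH]; [exact: swap_nil|exact: swap_cons]. Qed.

Lemma swap_sym p q : swap_eq p q -> swap_eq q p.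
Proof.
elim=> [|y {}p {}q _ IH|y a b w r {}p {}q sqy hp _ hq _].
- exact: swap_nil.
- exact: swap_cons.
- exact: (swap_square (sq_rev sqy) hq hp).
Qed.

Lemma swap_size p q : swap_eq p q -> size p = size q.
Proof.
by elim=> [|y {}p {}q _ /= ->|y a b w r {}p {}q _ _ /= -> _ ->].
Qed.

Lemma swap_consI y p l : swap_eq (y :: p) l -> exists q, l = y :: q /\
  (swap_eq p q \/ exists a b w r, [/\ sq y a w b, swap_eq p [:: a, w & r] &
     swap_eq q [:: b, w & r]]).
Proof.
move=> h; inversion h as [|y' p' q' e|y' a b w r p' q' sqy ep eq]; subst.
  by exists q'; split=> //; left.
by exists q'; split=> //; right; exists a, b, w, r.
Qed.

Lemma swap_cons2I y a p b q : swap_eq [:: y, a & p] [:: y, b & q] ->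
  swap_eq (a :: p) (b :: q) \/ exists w r, [/\ sq y a w b,
    swap_eq (a :: p) [:: a, w & r] & swap_eq (b :: q) [:: b, w & r]].
Proof.
move=> /swap_consI[_ [[<-] [|[a' [b' [w [r [sqy ea eb]]]]]]]]; first by left.
move: (ea) => /swap_consI[_ [[E _] _]]; move: (eb) => /swap_consI[_ [[E' _] _]].
by subst; right; exists w, r.
Qed.

Hypothesis X_cubical : cubical_complex X.
Hypothesis X_flag : forall v, @flag_link X v.

(* When the two swaps use different squares at the last vertex, the flag
   condition supplies the 3-cube through which the outer walks are related. *)
Lemma swap_trans p q s : swap_eq p q -> swap_eq q s -> swap_eq p s.
Proof.
move: {2}(size p) (leqnn (size p)) => n; elim: n => [|n IH] in p q s *.
  rewrite leqn0 => /nilP -> e; inversion e; subst; exact.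
case: p => [|y p]; first by move=> _ e; inversion e; subst; exact.
rewrite /= ltnS => pn /swap_consI[q' [-> e]] /swap_consI[s' [-> e']].
have {}IH p1 p2 p3 : size p1 = size p -> swap_eq p1 p2 -> swap_eq p2 p3 -> swap_eq p1 p3.
  by move=> ps; apply: IH; rewrite ps.
case: e => [e|[a [b [w [r [sqy ea eb]]]]]].
  have pq := swap_size e.
  case: e' => [e'|[a [b [w [r [sqy ea eb]]]]]]; first by apply: swap_cons; apply: IH e e'.
  by apply: (swap_square sqy _ eb); apply: IH ea.
have sa := swap_size ea; have sb := swap_size eb.
have sab : size q' = size p by rewrite sa sb.
case: e' => [e'|[b' [c [w' [r' [sqy' eb' ec]]]]]].
  apply: (swap_square sqy ea).
  by apply: (IH _ q') => //; [rewrite -(swap_size e')|exact: swap_sym].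
have sc := swap_size ec; have sb' := swap_size eb'.
have sc' : size s' = size p by rewrite -sab sb' sc.
have bb' : swap_eq [:: b, w & r] [:: b', w' & r'].
  by apply: (IH _ q') => //; exact: swap_sym.
have bE : b' = b by move: bb' => /swap_consI[? [[-> _]] _].
subst b'; have sq1 := sq_rot (sq_rot (sq_rot sqy)).
case: (swap_cons2I bb') => [ww'|[t [k [sq2 ewt ewt']]]].
  have ? : w' = w by move: ww' => /swap_consI[? [[-> _]] _].
  subst w'; have ac : a = c.
    exact: (sq_uniq X_cubical sq1 (sq_rev (sq_rot sqy'))).
  subst c; apply: swap_cons; apply: (IH _ _ _ _ ea) => //.
  by apply: (IH _ [:: a, w & r']) => //; [exact: swap_cons|exact: swap_sym].
have [z [_ [sqz sqwz sqw'z _ _]]] :=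
  cube3 X_cubical X_flag sq1 sq2 (sq_rev (sq_rot sqy')).
have step x v : sq v x z t -> swap_eq [:: x, v, t & k] [:: x, z, t & k].
  move=> sqv; apply: (@swap_square _ v z t k); do ?exact: swap_refl.
  exact: sq_rev (sq_rot sqv).
apply: (swap_square sqz (r := t :: k)).
  apply: (IH _ [:: a, w & r]) => //.
  apply: (IH _ [:: a, w, t & k]) => //; [exact: swap_cons|exact: step].
apply: (IH _ [:: c, w' & r']) => //.
apply: (IH _ [:: c, w', t & k]) => //; [by rewrite -sc|exact: swap_cons|exact: step].
Qed.

(** A square move at the last vertex would need a square with both diagonal corners equal to [y]. *)
Lemma swap_cancel x y r s : swap_eq [:: x, y & r] [:: x, y & s] ->
  swap_eq (y :: r) (y :: s).
Proof.
by move=> /swap_cons2I[//|[w [k [/sq_diag[_]]]]].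
Qed.

(** Reduced up to square moves: no initial part of the walk can be moved by squares to a walk whose
    last edge is undone by the next step. *)
Fixpoint reduced p : Prop :=
  if p is y :: p' then
    if p' is x :: _ then reduced p' /\ ~ exists r, swap_eq p' [:: x, y & r]
    else True
  else True.

Lemma swap_head x p q : swap_eq (x :: p) q -> exists q', q = x :: q'.
Proof. by move=> /swap_consI[q' [-> _]]; exists q'. Qed.

(** A square move creates no backtrack, because opposite sides of the square carry backtracks along.
    If the new step from [w] to [b] undid the walk before it, the old step from [a] to [y] would; if
    the new step from [b] to [y] did, the old step from [w] to [a] would. *)
Lemma reduced_swap p q : swap_eq p q -> reduced p -> reduced q.
Proof.
move: {2}(size p) (leqnn (size p)) => n; elim: n => [|n IH] in p q *.
  by rewrite leqn0 => /nilP -> e; inversion e.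
case: p => [|y p]; first by move=> _ e; inversion e.
rewrite /= ltnS => pn /swap_consI[q' [-> e]] {q}.
case: e => [e|[a [b [w [r [sqy ea eb]]]]]].
  case: p => [|x p] in pn e *; first by inversion e.
  have [q E] := swap_head e; subst q' => -[rp nb]; split; first exact: IH e rp.
  by move=> [r er]; apply: nb; exists r; apply: swap_trans er.
have [p' E] := swap_head (swap_sym ea); subst p.
have [q E] := swap_head (swap_sym eb); subst q'.
have sa := swap_size ea; have sb := swap_size eb.
move=> [/(IH _ _ pn ea)[rw nwa] nay].
have nwa' : ~ exists k, swap_eq (w :: r) [:: w, a & k] by [].
have {}nay k : ~ swap_eq [:: a, w & r] [:: a, y & k].
  by move=> e; apply: nay; exists k; apply: swap_trans e.
have rb : reduced [:: b, w & r].
  split=> // -[k ek]; apply: (nay (b :: k)).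
  apply: swap_trans (swap_cons a ek) _.
  by apply: (swap_square (sq_rot sqy)); exact: swap_refl.
split; first by apply: IH rb; [rewrite sa in pn|exact: swap_sym].
move=> [k ek]; have := swap_trans (swap_sym eb) ek.
move=> /swap_cons2I[/swap_head[? [wy _]]|[t [k' [sqb ew _]]]].
  by have [] := sq_diag sqy; rewrite wy.
have ta : t = a.
  by apply: (sq_uniq X_cubical sqb); apply: sq_rev; do 3!apply: sq_rot.
by apply: nwa'; exists k'; rewrite -ta.
Qed.

(* Appending the edge to y, with cancellation: if some walk equivalent to p has
   just traversed that edge backwards, the last step is undone instead. *)
Definition extend p y : seq X :=
  if p is x :: _ then
    if pselect (exists r, swap_eq p [:: x, y & r]) is left h
    then y :: projT1 (cid h) else y :: p
  else [:: y].

Arguments extend : simpl never.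

Variant extend_spec x p y : seq X -> Prop :=
| ExtendBack r of swap_eq (x :: p) [:: x, y & r] : extend_spec x p y (y :: r)
| ExtendForth of (forall r, ~ swap_eq (x :: p) [:: x, y & r]) :
    extend_spec x p y [:: y, x & p].

Lemma extendP x p y : extend_spec x p y (extend (x :: p) y).
Proof.
rewrite /extend; case: pselect => [h|h].
  by case: (cid h) => r e /=; exact: ExtendBack.
by apply: ExtendForth => r e; apply: h; exists r.
Qed.

Lemma extend_reduced x p y : reduced (x :: p) -> reduced (extend (x :: p) y).
Proof.
move=> rp; case: extendP => [r e|h]; last by split=> // -[r /h].
by have [] := reduced_swap e rp.
Qed.

Lemma extend_swap x p q y : swap_eq (x :: p) q ->
  swap_eq (extend (x :: p) y) (extend q y).
Proof.
move=> e; have [q' E] := swap_head e; subst q.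
case: extendP => [r er|h]; case: extendP => [s es|h'].
- apply: swap_cancel; apply: swap_trans (swap_sym er) _; exact: swap_trans es.
- by case: (h' r); apply: swap_trans er; exact: swap_sym.
- by case: (h s); apply: swap_trans es.
- exact: swap_cons.
Qed.

Lemma extend_backtrack x p y : reduced (x :: p) ->
  swap_eq (extend (extend (x :: p) y) x) (x :: p).
Proof.
move=> rp; case: extendP => [r e|h]; case: extendP => [s es|h'].
- by have [_ []] := reduced_swap e rp; exists s.
- exact: swap_sym.
- exact/swap_sym/(swap_cancel es).
- by case: (h' p); exact: swap_refl.
Qed.

(** With [extend_backtrack] this makes the action of edge paths invariant under elementary
    homotopies. The cases are which of the first steps, to [y] and to [t], cancel. *)
Lemma extend_square x y z t p : sq x y z t ->
  swap_eq (extend (extend (x :: p) y) z) (extend (extend (x :: p) t) z).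
Proof.
(* Only the step to [y'] cancels. The square then moves the walk through [t'] to one ending with the
   edge from [z] to [t'], so there the second step cancels, whereas after [y'] it cannot. *)
have wlog_case y' t' r : sq x y' z t' -> swap_eq (x :: p) [:: x, y' & r] ->
    (forall r, ~ swap_eq (x :: p) [:: x, t' & r]) ->
    swap_eq (extend (y' :: r) z) (extend [:: t', x & p] z).
  move=> sqx er h; case: extendP => [k ek|h1].
    case: (h (z :: k)); apply: swap_trans er _; apply: swap_trans (swap_cons x ek) _.
    by apply: (swap_square sqx); exact: swap_refl.
  have e1 : swap_eq [:: t', x & p] [:: t', z, y' & r].
    apply: swap_trans (swap_cons t' er) _.
    by apply: (@swap_square _ x z y' r); [do 3!apply: sq_rot|exact: swap_refl..].
  case: extendP => [k ek|h2]; last by case: (h2 _ e1).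
  apply: (@swap_cancel t'); exact: swap_trans (swap_sym e1) ek.
move=> sqx; have [xz yt] := sq_diag sqx.
have [r er|h] := extendP x p y; have [r' er'|h'] := extendP x p t.
- have [/swap_head[? [ty _]]|[w [k [sqw ey et]]]] :=
    swap_cons2I (swap_trans (swap_sym er) er'); first by case: yt.
  have ? := sq_uniq X_cubical sqw sqx; subst w.
  case: extendP => [s es|/(_ k)[]//]; case: extendP => [s' es'|/(_ k)[]//].
  apply: (@swap_trans _ (z :: k)).
    exact: swap_cancel (swap_trans (swap_sym es) ey).
  exact: swap_cancel (swap_trans (swap_sym et) es').
- exact: wlog_case.
- by apply: swap_sym; apply: wlog_case => //; exact: sq_rev.
(* If neither first step cancels, neither second step does: undoing the step to [z] would require a
   square, necessarily the given one, and would make the step to [t'] cancel. *)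
have no_back y' t' : sq x y' z t' -> (forall r, ~ swap_eq (x :: p) [:: x, t' & r]) ->
    forall k, ~ swap_eq [:: y', x & p] [:: y', z & k].
  move=> sq' ht k /swap_cons2I[/swap_head[? [zx _]]|[w [k' [sqw ex _]]]].
    by have [] := sq_diag sq'; rewrite zx.
  have ? := sq_uniq X_cubical sqw (sq_rev (sq_rot sq')); subst w.
  exact: ht ex.
case: extendP => [k /(no_back _ _ sqx h')//|_].
case: extendP => [k /(no_back _ _ (sq_rev sqx) h)//|_].
by apply: (@swap_square _ y t x p); [do 2!apply: sq_rot; exact: sq_rev|exact: swap_refl..].
Qed.

Definition walk u p : Prop :=
  if p is x :: q then edge_path x q /\ last x q = u else False.

Lemma edge_path_cons x y p : edge_path x (y :: p) <-> adjacent x y /\ edge_path y p.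
Proof. by rewrite /edge_path /=; split=> [/andP[/asboolP]|[/asboolT-> ->]]. Qed.

Lemma walk_cons u y x q :
  walk u [:: y, x & q] <-> adjacent y x /\ walk u (x :: q).
Proof. by rewrite /walk edge_path_cons /=; tauto. Qed.

Lemma walk_swap u p q : swap_eq p q -> walk u p <-> walk u q.
Proof.
elim=> [//|y {}p {}q e IH|y a b w r {}p {}q sqy ep IHp eq IHq].
  case: p => [|x p] in e IH *; first by inversion e.
  by have [q' E] := swap_head e; subst q; rewrite !walk_cons IH.
have [p' E] := swap_head (swap_sym ep); have [q' E'] := swap_head (swap_sym eq).
subst p q; have [_ ya aw wb byy] := sqy.
rewrite !walk_cons IHp IHq !walk_cons.
by split=> -[_ [_ h]]; (split; last split=> //) => //; exact: adjacentC.
Qed.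

Lemma extend_walk u x p y : adjacent x y -> walk u (x :: p) ->
  walk u (extend (x :: p) y) /\ exists q, extend (x :: p) y = y :: q.
Proof.
move=> xy wp; case: extendP => [r e|h]; split.
- by move: wp; rewrite (walk_swap u e) walk_cons => -[].
- by exists r.
- by rewrite walk_cons; split=> //; exact: adjacentC.
- by exists (x :: p).
Qed.

Lemma foldl_extend_walk u x p l : edge_path x l -> walk u (x :: p) ->
  reduced (x :: p) -> let q := foldl extend (x :: p) l in
  [/\ walk u q, reduced q & exists q', q = last x l :: q'].
Proof.
elim: l x p => [|y l IH] x p /=; first by split=> //; exists p.
move=> /edge_path_cons[xy yl] wp rp.
have [w' [q E]] := extend_walk xy wp; have := extend_reduced y rp.
by rewrite {}E in w' * => r'; exact: (IH y q yl w' r').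
Qed.

Lemma foldl_extend_swap u x p q l : edge_path x l -> walk u (x :: p) ->
  swap_eq (x :: p) q -> swap_eq (foldl extend (x :: p) l) (foldl extend q l).
Proof.
elim: l x p q => [|y l IH] x p q //= /edge_path_cons[xy yl] wp e.
have := extend_swap y e; have [w' [q' E]] := extend_walk xy wp.
by rewrite {}E in w' *; exact: IH.
Qed.

(** [rev (belast x l)] is the way back along [l] without its starting vertex, and each of its steps
    undoes one step of [l] by [extend_backtrack]. *)
Lemma extend_undo u x p l : edge_path x l -> walk u (x :: p) -> reduced (x :: p) ->
  swap_eq (foldl extend (foldl extend (x :: p) l) (rev (belast x l))) (x :: p).
Proof.
elim: l x p => [|y l IH] x p /=; first by move=> *; exact: swap_refl.
move=> /edge_path_cons[xy yl] wp rp; rewrite rev_cons -cats1 foldl_cat /=.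
have back := extend_backtrack y rp; have r' := extend_reduced y rp.
have [w' [q E]] := extend_walk xy wp; rewrite E in w' r' back *.
apply: swap_trans back; have e := IH y q yl w' r'.
by have [s Es] := swap_head (swap_sym e); rewrite {}Es in e *; exact: extend_swap.
Qed.

(** The same walks as in [walk], listed from the first vertex to the last, the order in which
    [foldl extend] reads a path. *)
Definition walk_from u l : Prop := if l is x :: s then x = u /\ edge_path x s else False.

Lemma walk_from_cat u p x s :
  walk_from u (p ++ x :: s) <-> walk_from u (rcons p x) /\ edge_path x s.
Proof.
case: p => [|y p] /=; first by split=> [[-> ?]|[[-> _]]].
rewrite /edge_path cat_path rcons_path /=.
by split=> [[-> /and3P[-> -> ->]]|[[-> /andP[-> ->]] ->]].
Qed.

Lemma foldl_extend_from u l : walk_from u l ->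
  [/\ walk u (foldl extend [::] l), reduced (foldl extend [::] l) &
      exists q, foldl extend [::] l = last u l :: q].
Proof. by case: l => [//|x l] [-> ul]; exact: foldl_extend_walk. Qed.

(** [homotopic] relates arbitrary lists; the first conjunct keeps every list of the chain a walk
    from [u]. For a single move the common prefix builds one reduced walk, the two sides of the move
    act equally on it, and the common suffix preserves equivalence. *)
Lemma foldl_extend_homotopic u l l' : homotopic l l' ->
  (walk_from u l <-> walk_from u l') /\ (walk_from u l ->
   swap_eq (foldl extend [::] l) (foldl extend [::] l')).
Proof.
elim=> {l l'} [l l' []|l|l l' _ [h e]|l1 l2 l3 _ [h e] _ [h' e']].
- move=> p q x y xy; have yx := adjacentC xy.
  have iff : walk_from u (p ++ [:: x, y, x & q]) <-> walk_from u (p ++ [:: x & q]).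
    by rewrite !walk_from_cat !edge_path_cons; tauto.
  split=> // /walk_from_cat[wp]; rewrite !edge_path_cons => -[_ [_ xq]].
  have [wP rP [P PE]] := foldl_extend_from wp.
  rewrite -!(cat_rcons x p) !foldl_cat {}PE last_rcons in wP rP * => /=.
  have back := extend_backtrack y rP.
  have [s E] := swap_head (swap_sym back); rewrite {}E in back *.
  apply: (foldl_extend_swap (u := u)) => //; exact/(walk_swap u back).
- move=> p q x y z t sqx xy yz zt tx.
  have {sqx}sqx : sq x y z t by split.
  have xt := adjacentC tx; have tz := adjacentC zt.
  have iff : walk_from u (p ++ [:: x, y, z & q]) <-> walk_from u (p ++ [:: x, t, z & q]).
    by rewrite !walk_from_cat !edge_path_cons; tauto.
  split=> // /walk_from_cat[wp]; rewrite !edge_path_cons => -[_ [_ zq]].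
  have [wP rP [P PE]] := foldl_extend_from wp.
  rewrite -!(cat_rcons x p) !foldl_cat {}PE last_rcons in wP rP * => /=.
  have e := extend_square P sqx.
  have [w1 [q1 E1]] := extend_walk xy wP.
  rewrite {}E1 in w1 e *; have [w2 [q2 E2]] := extend_walk yz w1.
  rewrite {}E2 in w2 e *; exact: (foldl_extend_swap (u := u)).
- by split=> // _; exact: swap_refl.
- by split=> [|/h/e]; [rewrite h|exact: swap_sym].
- split=> [|wl]; first by rewrite h.
  by apply: swap_trans (e wl) (e' _); apply/h.
Qed.

Lemma walk_from_rev u p : walk u p -> walk_from u (rev p).
Proof.
case: p => [//|x p] [xp lp]; rewrite lastI rev_rcons lp; split=> //.
rewrite /edge_path -lp rev_path; apply: sub_path xp => a b /asboolP ab.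
exact/asboolP/adjacentC.
Qed.

Lemma foldl_extend_rev u p : walk u p -> reduced p ->
  swap_eq (foldl extend [::] (rev p)) p.
Proof.
elim: p => [//|y p IH]; case: p => [|x p] in IH *; first by move=> *; exact: swap_refl.
move=> /walk_cons[_ wp] [rp nb].
rewrite rev_cons -cats1 foldl_cat /=.
have e := IH wp rp; have [s E] := swap_head (swap_sym e); rewrite E in e *.
apply: swap_trans (extend_swap y e) _.
case: extendP => [r er|_]; last exact: swap_refl.
by case: nb; exists r.
Qed.

Hypothesis X_sc : simply_connected X.

(** The normal form theorem: each vertex is reached from [u] by one reduced walk up to square
    moves. *)
Lemma reduced_uniq u x p q : walk u (x :: p) -> walk u (x :: q) ->
  reduced (x :: p) -> reduced (x :: q) -> swap_eq (x :: p) (x :: q).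
Proof.
move=> wp wq rp rq; have [_ sc] := X_sc.
(* The loop at [u] that runs along [x :: p] to [x] and returns along [q]; it is null-homotopic. *)
have wl : walk_from u (rev (x :: p) ++ q).
  rewrite rev_cons cat_rcons walk_from_cat -rev_cons; split; last by case: wq.
  exact: walk_from_rev.
have ll : last u (rev (x :: p) ++ q) = u.
  by rewrite last_cat rev_cons last_rcons; case: wq.
case E : (rev (x :: p) ++ q) => [|u' l] in wl ll.
  by case: wl.
case: wl => ? ul; subst u'.
have [_ e] := foldl_extend_homotopic u (sc u l ul ll).
have {}e : swap_eq (foldl extend (x :: p) q) [:: u].
  apply: (@swap_trans _ (foldl extend [::] (u :: l))); last by apply: e.
  rewrite -E foldl_cat; apply: (foldl_extend_swap (u := u)) => //; first by case: wq.
  exact/swap_sym/(foldl_extend_rev wp).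
have [xq lq] := wq.
(* Following [q] and then retracing it restores [x :: p]. As following [q] led to the trivial walk,
   the retracing also rebuilds [x :: q]. *)
apply: swap_trans (swap_sym (extend_undo xq wp rp)) _.
apply: swap_trans (foldl_extend_rev wq rq).
rewrite (lastI x q) rev_rcons lq -(rev_rcons _ u).
have [w' r' [s Es]] := foldl_extend_walk xq wp rp.
rewrite Es in e w' r' *; rewrite rev_rcons /=.
apply: (foldl_extend_swap (u := u) _ w' e).
rewrite /edge_path rev_path; apply: sub_path xq => a b /asboolP ab.
exact/asboolP/adjacentC.
Qed.

Lemma nonreduced_shorten u p x : walk u (x :: p) -> ~ reduced (x :: p) ->
  exists2 q, walk u (x :: q) & size q < size p.
Proof.
elim: p x => [|y p IH] x; first by move=> _ [].
move=> /walk_cons[xy wp] nr; have [rp|/(IH y wp)[q wq qp]] := pselect (reduced (y :: p)).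
  have [r er] : exists r, swap_eq (y :: p) [:: y, x & r].
    by apply: contrapT => h; apply: nr.
  exists r; first by move: wp; rewrite (walk_swap u er) walk_cons => -[].
  by move: (swap_size er) => /= [->]; rewrite ltnS leqnSn.
by exists (y :: q) => //; rewrite walk_cons.
Qed.

(** * The graph distance and the quadrangle condition *)

Lemma walk_exists u x : exists n, `[< exists2 p, walk u (x :: p) & size p = n >].
Proof.
have [[_ /(_ x u)[p [xp lp]]] _] := X_sc.
by exists (size p); apply/asboolP; exists p.
Qed.

Definition dist u x : nat := ex_minn (walk_exists u x).

Lemma dist_walk u x : exists2 p, walk u (x :: p) & size p = dist u x.
Proof. by rewrite /dist; case: ex_minnP => n /asboolP. Qed.

Lemma dist_min u x p : walk u (x :: p) -> dist u x <= size p.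
Proof.
by move=> wp; rewrite /dist; case: ex_minnP => n _; apply; apply/asboolP; exists p.
Qed.

Lemma geodesic_reduced u x p : walk u (x :: p) -> size p = dist u x -> reduced (x :: p).
Proof.
move=> wp sp; apply: contrapT => /(nonreduced_shorten wp)[q /dist_min].
by rewrite sp leqNgt => /negP.
Qed.

(** By [reduced_uniq] a reduced walk is equivalent to a geodesic with the same ends, and square
    moves preserve length. *)
Lemma reduced_geodesic u x p : walk u (x :: p) -> reduced (x :: p) -> size p = dist u x.
Proof.
move=> wp rp; have [q wq sq_] := dist_walk u x.
have := swap_size (reduced_uniq wp wq rp (geodesic_reduced wq sq_)).
by rewrite -sq_ => -[].
Qed.

Lemma distxx u : dist u u = 0.
Proof. by apply/eqP; rewrite -leqn0; apply: (@dist_min u u [::]). Qed.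

Lemma dist_eq0 u x : dist u x = 0 -> x = u.
Proof. by have [[|y p] [xp /= lp] <-] := dist_walk u x. Qed.

(** The graph is bipartite: [extend] changes the length of a reduced walk by exactly one, and
    reduced walks are geodesics. *)
Lemma dist_adj u x y : adjacent x y ->
  dist u y = (dist u x).+1 \/ dist u x = (dist u y).+1.
Proof.
move=> xy; have [p wp sp] := dist_walk u x; have rp := geodesic_reduced wp sp.
have [w' _] := extend_walk xy wp; have r' := extend_reduced y rp.
rewrite -sp; case: extendP w' r' => [r e|h] w' r'.
  by right; rewrite -(reduced_geodesic w' r'); move: (swap_size e) => -[].
by left; rewrite -(reduced_geodesic w' r').
Qed.

Lemma dist_pred u x n : dist u x = n.+1 -> exists2 y, adjacent x y & dist u y = n.
Proof.
move=> dn; have [[|y p] wp sp] := dist_walk u x; first by rewrite dn in sp.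
have [xy wy] := (walk_cons _ _ _ _).1 wp; exists y => //.
rewrite dn in sp; case: (sp) => <-; apply/esym/reduced_geodesic => //.
by have [] : reduced [:: x, y & p] by apply: geodesic_reduced wp _; rewrite dn.
Qed.

(** The geodesics to [z] through [a] and through [b] are equivalent; since [a <> b], the equivalence
    uses a square at [z]. *)
Lemma quadrangle u z a b n : adjacent z a -> adjacent z b -> a <> b ->
  dist u z = n.+1 -> dist u a = n -> dist u b = n ->
  exists2 w, sq z a w b & (dist u w).+1 = n.
Proof.
move=> za zb ab dz da db.
have [p wp sp] := dist_walk u a; have [q wq sq_] := dist_walk u b.
have wp' : walk u [:: z, a & p] by rewrite walk_cons.
have wq' : walk u [:: z, b & q] by rewrite walk_cons.
have rp : reduced [:: z, a & p] by apply: geodesic_reduced wp' _; rewrite /= sp da dz.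
have rq : reduced [:: z, b & q] by apply: geodesic_reduced wq' _; rewrite /= sq_ db dz.
have [/swap_head[? [E _]]|[w [r [sqz ea _]]]] := swap_cons2I (reduced_uniq wp' wq' rp rq).
  by case: ab.
exists w => //; have [_ _ /adjacentC wa _ _] := sqz.
have /walk_cons[_ ww] := (walk_swap u ea).1 wp.
have := dist_min ww; move: (swap_size ea) => /= [spr].
rewrite spr da in sp; rewrite -sp /= => le.
case: (dist_adj u wa) => E; first by rewrite -E da sp.
by move: le; rewrite E da -sp ltnNge leqW.
Qed.

Lemma distC u x : dist u x = dist x u.
Proof.
suff le y z : dist y z <= dist z y by apply/eqP; rewrite eqn_leq !le.
have [p wp <-] := dist_walk z y.
move: (walk_from_rev wp); case: wp => yp lp; rewrite lastI rev_rcons lp => -[_ zp].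
suff /dist_min : walk y (z :: rev (belast y p)) by rewrite size_rev size_belast.
by split=> //; case: p {yp zp} lp => [//|x' p] /= _; rewrite rev_cons last_rcons.
Qed.

Lemma dist_triangle x y z : dist x z <= dist x y + dist y z.
Proof.
move En : (dist y z) => n; elim: n => [|n IH] in z En *.
  by rewrite (dist_eq0 En) addn0.
have [w zw dw] := dist_pred En; have := IH w dw; rewrite addnS.
have [->|->] := dist_adj x zw.
  by move=> /ltnW/leqW.
by rewrite ltnS.
Qed.

Lemma dist_adj1 x y : adjacent x y -> dist x y = 1.
Proof. by move=> xy; have := dist_adj x xy; rewrite distxx => -[|]. Qed.

End Walks.

Lemma set2_eq (T : Type) (a b c d : T) : [set a; b] = [set c; d] ->
  a = c /\ b = d \/ a = d /\ b = c.
Proof.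
move=> E.
have : [set c; d] a by rewrite -E; left.
have : [set c; d] b by rewrite -E; right.
have : [set a; b] c by rewrite E; left.
have : [set a; b] d by rewrite E; right.
move=> [?|?] [?|?] [?|?] [?|?];
  by [left; split; congruence|right; split; congruence].
Qed.

(** * Halfspaces, carriers and medians *)

Section Hyperplanes.
Variable X : cube_system.
Hypothesis X_cubical : cubical_complex X.
Hypothesis X_flag : forall v : X, flag_link v.
Hypothesis X_sc : simply_connected X.
Implicit Types (x y z a b c u v w : X) (h k m : hyperplane X).

Local Notation d := (dist X_sc).

Let d_adj u x y : adjacent x y -> d u y = (d u x).+1 \/ d u x = (d u y).+1.
Proof. exact: dist_adj. Qed.
Let d_sym x y : d x y = d y x.
Proof. exact: distC. Qed.
Let d_pred u x n : d u x = n.+1 -> exists2 y, adjacent x y & d u y = n.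
Proof. exact: dist_pred. Qed.
Let d_tri x y z : d x z <= d x y + d y z.
Proof. exact: dist_triangle. Qed.
Let dxx x : d x x = 0.
Proof. exact: distxx. Qed.
Let d_eq0 u x : d u x = 0 -> x = u.
Proof. exact: dist_eq0. Qed.
Let d_adj1 x y : adjacent x y -> d x y = 1.
Proof. exact: dist_adj1. Qed.
Let quad u z a b n : adjacent z a -> adjacent z b -> a <> b ->
  d u z = n.+1 -> d u a = n -> d u b = n ->
  exists2 w, sq z a w b & (d u w).+1 = n.
Proof. exact: quadrangle. Qed.

Definition halfspace a b : set X := [set x | d x a < d x b].
Local Notation W := halfspace.

Lemma halfspaceC a b x : adjacent a b -> W b a x <-> ~ W a b x.
Proof. by move=> /(d_adj x); rewrite /halfspace /=; lia. Qed.

(** Otherwise the distances from [x] to [a], [b], [c], [e] alternate, [b] and [e] being the farther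
    ones. The quadrangle condition at [b] gives a fourth corner nearer than [a], but that corner is
    [e]. *)
Lemma halfspace_sq_sub a b c e : sq a b c e -> W a b `<=` W e c.
Proof.
move=> sqa x; rewrite /halfspace /= => xab.
have [_ ab bc ce ea] := sqa; have [ac be] := sq_diag sqa.
have := d_adj x ab; have := d_adj x bc; have := d_adj x ce; have := d_adj x ea.
have [//|le] := ltnP (d x e) (d x c) => h1 h2 h3 h4.
have [|||w sqw dw] := @quad x b a c (d x a) (adjacentC ab) bc ac; try lia.
have : w = e.
  apply: (sq_uniq X_cubical sqw); do 3!apply: sq_rot; exact: sq_rev.
by move=> wE; subst w; lia.
Qed.

Lemma halfspace_sq a b c e : sq a b c e -> W a b = W e c.
Proof.
move=> sqa; apply/seteqP; split; apply: halfspace_sq_sub => //.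
by apply: sq_rot; exact: sq_rev.
Qed.

(** The invariant of a parallelism class is the unordered pair of halfspaces, written as a set
    indexed by the two orientations of the edge. *)
Lemma halfspace_parallel e e' : parallel e e' ->
  [set W p.1 p.2 | p in [set p | adjacent p.1 p.2 /\ e = [set p.1; p.2]]] =
  [set W p.1 p.2 | p in [set p | adjacent p.1 p.2 /\ e' = [set p.1; p.2]]].
Proof.
elim=> {e e'} [e e' opp|//|e e' _ -> //|e1 e2 e3 _ -> _ //].
have incl f g : opposite_edges f g ->
    [set W p.1 p.2 | p in [set p | adjacent p.1 p.2 /\ f = [set p.1; p.2]]] `<=`
    [set W p.1 p.2 | p in [set p | adjacent p.1 p.2 /\ g = [set p.1; p.2]]].
  move=> opp' _ [[a b] [/= ab fE] <-]; have [_ [c [e'' [ce gE]]] _ _] := opp'.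
  rewrite fE gE in opp'; have [s|s] := opposite_sq X_cubical ab ce opp'.
    exists (e'', c) => /=; last by rewrite (halfspace_sq s).
    by split; [exact: adjacentC|rewrite gE setUC].
  by exists (c, e''); rewrite //= (halfspace_sq s).
apply/seteqP; split; apply: incl => //.
by case: opp => *; split=> //; [exact: span_square_sym|rewrite setIC].
Qed.

Lemma parallel_halfspace a b x y : adjacent a b -> parallel [set a; b] [set x; y] ->
  W a b = W x y \/ W a b = W y x.
Proof.
move=> ab /halfspace_parallel /seteqP[h _].
have [|[p q] [_ /= E] <-] := h (W a b).
  by exists (a, b).
by case: (set2_eq E) => -[-> ->]; [left|right].
Qed.

(** Induction on the distance from [a] to [x]. With [x'] one step nearer to [a], the quadrangle
    condition seen from [b] closes a square on [x'], [x], [y], whose side opposite to [x y] crosses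
    nearer to [a]. *)
Lemma parallel_crossing a b x y : adjacent a b -> adjacent x y ->
  W a b x -> W b a y -> parallel [set a; b] [set x; y].
Proof.
move=> ab; move En : (d a x) => n; elim: n => [|n IH] in x y En * => xy wx wy.
  have xa := d_eq0 En; subst x; move: wy; rewrite /halfspace /= d_sym (d_sym y a).
  have ya := d_adj1 xy; rewrite ya => yb0.
  have /d_eq0 -> : d b y = 0 by lia.
  exact: rst_refl.
have [x' xx' dx'] := d_pred En.
move: (wx) (wy); rewrite /halfspace /= !(d_sym _ a) !(d_sym _ b) => wx' wy'.
have := d_adj a xy; have := d_adj b xy; have := d_adj x ab.
have := d_adj y ab; have := d_adj b xx'; have := d_adj x' ab.
rewrite !(d_sym x) !(d_sym x') !(d_sym y) => h1 h2 h3 h4 h5 h6.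
have ne : x' <> y by move=> E; subst x'; lia.
have [|||w sqx dw] := @quad b x x' y (d b y) xx' xy ne; try lia.
have [_ _ x'w wy_ _] := sqx.
have := d_adj a wy_; have := d_adj w ab; rewrite !(d_sym w) => h7 h8.
apply: (@rst_trans _ _ _ [set x'; w]); last first.
  apply: rst_sym; apply: rst_step; apply: sq_opposite; exact: sq_rev.
apply: IH => //; rewrite /halfspace /= ?(d_sym x') ?(d_sym w); lia.
Qed.

Lemma halfspace_crossing a b x y : adjacent a b -> adjacent x y ->
  W a b x -> W b a y -> W a b = W x y.
Proof.
move=> ab xy wx wy.
have [//|E] := parallel_halfspace ab (parallel_crossing ab xy wx wy).
by move: wx; rewrite E /halfspace /= dxx.
Qed.

Definition crosses h x y := adjacent x y /\ sval h [set x; y].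

Lemma crossesC h x y : crosses h x y -> crosses h y x.
Proof. by move=> [/adjacentC xy hxy]; split; rewrite // setUC. Qed.

Lemma hyperplane_parallel h e e' : sval h e -> sval h e' <-> parallel e e'.
Proof.
case: h => W' /= [e0 [_ ->]] e0e; split=> [|ee'].
  by apply: rst_trans; exact: rst_sym.
exact: rst_trans ee'.
Qed.

Lemma hyperplane_edge h e : sval h e -> is_edge e.
Proof.
case: h => W' /= [e0 [ee0 ->]] p.
suff : is_edge e0 <-> is_edge e by move=> <-.
elim: p => [a b [? ?]|a|a b _ ->|a b c _ -> _ ->] //; by split.
Qed.

Lemma hyperplane_crosses h e : sval h e ->
  exists x y, crosses h x y /\ e = [set x; y].
Proof.
move=> he; have [x [y [xy E]]] := hyperplane_edge he.
by exists x, y; split=> //; split; rewrite -?E.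
Qed.

Lemma hyperplane_uniq h k e : sval h e -> sval k e -> h = k.
Proof.
move=> he ke; apply: hyperplane_eq; apply/seteqP; split=> e'.
  by move/(hyperplane_parallel _ he)/(hyperplane_parallel _ ke).
by move/(hyperplane_parallel _ ke)/(hyperplane_parallel _ he).
Qed.

Lemma crosses_uniq h k x y : crosses h x y -> crosses k x y -> h = k.
Proof. by move=> [_ he] [_]; exact: hyperplane_uniq. Qed.

Lemma adjacent_crosses x y : adjacent x y -> exists h, crosses h x y.
Proof.
move=> xy; have hW : is_hyperplane [set e | parallel [set x; y] e].
  by exists [set x; y]; split=> //; exists x, y.
by exists (exist _ _ hW); split=> //; exact: rst_refl.
Qed.

Lemma crossesP h a b x y : crosses h a b -> adjacent x y -> W a b x ->
  crosses h x y <-> W b a y.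
Proof.
move=> [ab hab] xy wx; split=> [[_ /(hyperplane_parallel _ hab)]|wy].
  move=> /(parallel_halfspace ab) E; apply/(halfspaceC _ ab).
  case: E => E; last by move: wx; rewrite E /halfspace /= dxx.
  by rewrite E /halfspace /= dxx.
by split=> //; apply/(hyperplane_parallel _ hab); exact: parallel_crossing.
Qed.

Lemma crosses_halfspace h a b x y : crosses h a b -> crosses h x y ->
  W a b x -> W a b = W x y.
Proof.
move=> hab hxy wx; have [[ab _] [xy _]] := (hab, hxy).
by apply: halfspace_crossing => //; apply/(crossesP hab xy wx).
Qed.

Lemma halfspace_self a b : adjacent a b -> W a b a.
Proof. by move=> ab; rewrite /halfspace /= dxx d_adj1. Qed.

(** Crossing [h] puts [b] in the halfspace of [a], so [b] is nearer to [a] than to [v], hence at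
    distance 0. *)
Lemma crosses_same h v a b : crosses h v a -> crosses h v b -> a = b.
Proof.
move=> ha hb; have [[va _] [vb _]] := (ha, hb).
have /(crossesP ha vb (halfspace_self va)) := hb.
rewrite /halfspace /= (d_sym b v) (d_adj1 vb) => ba; apply: d_eq0; lia.
Qed.

Lemma crosses_sq h a b c e : sq a b c e -> crosses h a b -> crosses h e c.
Proof.
move=> sqa [ab hab]; have [_ _ _ ce _] := sqa.
split; first exact: adjacentC.
by apply/(hyperplane_parallel _ hab); apply: rst_step; exact: sq_opposite.
Qed.

(** * Convexity of carriers, medians and separation *)

Definition between x z y := d x z + d z y = d x y.
Definition convex (C : set X) := forall x y z, C x -> C y -> between x z y -> C z.

Lemma between_step x z y : between x z y -> z <> x ->
  exists x1, [/\ adjacent x x1, (d x1 y).+1 = d x y & between x1 z y /\ (d x1 z).+1 = d x z].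
Proof.
move=> bz zx; case En : (d z x) => [|n]; first by case: zx; rewrite (d_eq0 En).
have [x1 xx1 d1] := d_pred En; exists x1.
have := d_adj y xx1; have := d_tri x1 z y; have := d_sym z x; have := d_sym z x1.
have := d_sym y x; have := d_sym y x1; move: bz; rewrite /between.
by split; [|lia|split; lia].
Qed.

Lemma convexI (A B : set X) : convex A -> convex B -> convex (A `&` B).
Proof. by move=> cA cB x y z [Ax Bx] [Ay By] b; split; [exact: cA b|exact: cB b]. Qed.

Lemma convex_step (C : set X) : (forall x y x1, C x -> C y -> adjacent x x1 ->
  (d x1 y).+1 = d x y -> C x1) -> convex C.
Proof.
move=> step x y z Cx Cy; move En : (d x z) => n; elim: n => [|n IH] in x Cx En *.
  by rewrite (d_eq0 En).
move=> b; have [|x1 [xx1 d1 [b1 e1]]] := between_step b.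
  by move=> zx; move: En; rewrite zx dxx.
by apply: (IH x1) => //; [exact: step d1|lia].
Qed.

Definition carrier h : set X := [set v | exists w, crosses h v w].

Lemma crosses_carrier h x y : crosses h x y -> carrier h x /\ carrier h y.
Proof. by move=> hxy; split; [exists y|exists x; exact: crossesC]. Qed.

Lemma carrier_neq0 h : carrier h !=set0.
Proof.
have [e [[x [y [xy eE]]] WE]] := svalP h; exists x, y; split=> //.
by rewrite WE -eE; exact: rst_refl.
Qed.

(** Seen from [w'], the other end of the edge of [h] at [w], both [v'] and [x1] are one nearer than
    [v]; the quadrangle condition closes the square. *)
Lemma carrier_step_same h v v' w x1 : crosses h v v' -> carrier h w -> W v v' w ->
  adjacent v x1 -> (d x1 w).+1 = d v w -> ~ crosses h v x1 ->
  exists z, sq v v' z x1.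
Proof.
move=> hv [w' hw] wvw vx1 d1 nh; have [[vv' _] [ww' _]] := (hv, hw).
have E := crosses_halfspace hv hw wvw.
have wx1 : W v v' x1.
  by apply: contrapT => /(halfspaceC _ vv') /(crossesP hv vx1 (halfspace_self vv')).
have ne : v' <> x1 by move=> ne; apply: nh; rewrite -ne.
have wv : W w w' v by rewrite -E; exact: halfspace_self.
have wx : W w w' x1 by rewrite -E.
have /(halfspaceC _ vv') ww : ~ W v v' w'.
  by rewrite E; apply/(halfspaceC _ ww'); exact/halfspace_self/adjacentC.
move: ww wv wx; rewrite /halfspace /= => ww wv wx.
have := d_adj v ww'; have := d_adj x1 ww'; have := d_adj w' vv'.
rewrite !(d_sym w') => h1 h2 h3; rewrite !(d_sym w') in ww.
have [|||z sqz _] := @quad w' v v' x1 (d v w) vv' vx1 ne; rewrite ?(d_sym w'); try lia.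
by exists z.
Qed.

Lemma carrier_convex h : convex (carrier h).
Proof.
apply: convex_step => v w x1 [v' hv] cw vx1 d1.
have [/crosses_carrier[_ //]|nh] := pselect (crosses h v x1).
have [vv' _] := hv.
(* If [w] lies on the other side of [h], it is replaced by its neighbour across [h]. *)
suff [w0 [cw0 wv d0]] : exists w0, [/\ carrier h w0, W v v' w0 & (d x1 w0).+1 = d v w0].
  have [z sqz] := carrier_step_same hv cw0 wv vx1 d0 nh.
  by exists z; exact: crosses_sq hv.
have [wv|nwv] := pselect (W v v' w); first by exists w.
have {}nwv : W v' v w by exact/(halfspaceC _ vv').
have wx1 : W v v' x1.
  by apply: contrapT => /(halfspaceC _ vv') /(crossesP hv vx1 (halfspace_self vv')).
have [w' hw] := cw; have [ww' _] := hw; exists w'.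
have wv' : W v v' w'.
  apply/(halfspaceC _ (adjacentC vv')).
  by rewrite (crosses_halfspace (crossesC hv) hw nwv) /halfspace /= dxx.
have E := crosses_halfspace hv (crossesC hw) wv'.
split=> //; first by have [] := crosses_carrier hw.
have := halfspace_self vv'; move: wx1; rewrite E /halfspace /=.
have := d_adj v ww'; have := d_adj x1 ww'; lia.
Qed.

Lemma carrier_sq h v v' w : crosses h v v' -> carrier h w -> adjacent v w ->
  ~ crosses h v w -> exists z, sq v v' z w.
Proof.
move=> hv cw vw nh; have [vv' _] := hv.
apply: (carrier_step_same hv cw _ vw) => //; last by rewrite dxx d_adj1.
by apply: contrapT => /(halfspaceC _ vv') /(crossesP hv vw (halfspace_self vv')).
Qed.

(* The square moves push the step z' - z, which approaches y, down a geodesic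
   from z' to x until it becomes a step x - x1. *)
Lemma median_descent (k : nat) x y z z' : d x z' = k -> d x z = k.+1 -> adjacent z z' ->
  d y z' = d y x + k -> (d y z).+1 = d y z' ->
  exists x1, [/\ adjacent x x1, (d y x1).+1 = d y x & d x1 z = k].
Proof.
elim: k z z' => [|k IH] z z' xz' xz zz' yz' yz.
  have E := d_eq0 xz'; subst z'; exists z; split=> //; exact: adjacentC.
have [z2 z'z2 xz2] := d_pred xz'; have := d_adj y z'z2; have := d_tri y x z2.
move=> t1 t2; have ne : z <> z2 by move=> E; subst z2; lia.
have [|||w sqz yw] := @quad y z' z z2 (d y z) (adjacentC zz') z'z2 ne; try lia.
have [_ _ zw wz2 _] := sqz; have := d_adj x zw; have := d_adj x wz2 => t3 t4.
have [|||||x1 [xx1 yx1 x1w]] := IH w z2 => //; try lia.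
exists x1; split=> //.
have := d_tri x1 w z; have := d_tri x x1 z.
by rewrite (d_adj1 xx1) (d_adj1 (adjacentC zw)); lia.
Qed.

(** Induction on the distance from [x] to [z], with [z'] one step before [z]. A step from [x]
    towards [y] and [z'] also approaches [z]. If [x] lies between [y] and [z'], either it lies
    between [y] and [z] or [median_descent] applies. *)
Lemma median_step x y z : between y x z \/
  exists x1, [/\ adjacent x x1, (d y x1).+1 = d y x & (d z x1).+1 = d z x].
Proof.
move En : (d x z) => k; elim: k => [|k IH] in z En *.
  by left; rewrite (d_eq0 En) /between dxx addn0.
have [z' zz' xz'] := d_pred En.
case: (IH _ xz') => [b|[x1 [xx1 yx1 zx1]]]; last first.
  right; exists x1; split=> //; have := d_tri x x1 z; have := d_tri x1 z' z.
  rewrite (d_adj1 xx1) (d_adj1 (adjacentC zz')) !(d_sym z) (d_sym x1 z').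
  by move: zx1; rewrite (d_sym z' x); lia.
move: b; rewrite /between => b; have := d_adj y zz'; case=> yz; last by left; lia.
have [|||||x1 [xx1 yx1 x1z]] := @median_descent k x y z z' => //; try lia.
by right; exists x1; split=> //; rewrite !(d_sym z); lia.
Qed.

(** Moving [x] towards both other vertices until it lies between them ends at a median. *)
Lemma median x y z : exists m : X, [/\ between x m y, between x m z & between y m z].
Proof.
move En : (d y x) => n; elim: n => [|n IH] in x En *.
  by rewrite (d_eq0 En); exists y; rewrite /between dxx.
have [b|[x1 [xx1 yx1 zx1]]] := median_step x y z.
  by exists x; split=> //; rewrite /between dxx.
have [|m [b1 b2 b3]] := IH x1; first lia.
have := d_tri x x1 m; have := d_tri x m y; have := d_tri x m z.
have := d_sym y x1; have := d_sym y x; have := d_sym z x1; have := d_sym z x.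
have := d_adj1 xx1; exists m; move: b1 b2; rewrite /between.
by split=> //; lia.
Qed.

(** The edge is the first one of a shortest geodesic from [C] to [D]. *)
Lemma separation (C D : set X) : convex C -> convex D -> C !=set0 -> D !=set0 ->
  C `&` D = set0 -> exists a b, [/\ adjacent a b, C `<=` W a b & D `<=` W b a].
Proof.
move=> cC cD [c0 Cc0] [d0 Dd0] CD.
pose P n := `[< exists c e, [/\ C c, D e & d c e = n] >].
have exP : exists n, P n by exists (d c0 d0); apply/asboolP; exists c0, d0.
case: (ex_minnP exP) => n /asboolP[c [e [Cc De En]]] min.
have {}min x y : C x -> D y -> n <= d x y.
  by move=> Cx Dy; apply: min; apply/asboolP; exists x, y.
case: n => [|n] in En min.
  have : (C `&` D) c by split=> //; rewrite -(d_eq0 En).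
  by rewrite CD.
rewrite d_sym in En; have [c1 cc1 d1] := d_pred En.
exists c, c1; split=> // y.
  move=> Cy; apply: contrapT => /(halfspaceC _ cc1); rewrite /halfspace /= => yc.
  have Cc1 : C c1.
    apply: cC Cy Cc _; rewrite /between; have := d_adj y cc1.
    by rewrite (d_sym c1) (d_adj1 cc1); lia.
  by have := min _ _ Cc1 De; rewrite d_sym; lia.
(* The median lies in [D] and on a geodesic from [c] to [e], so minimality makes it [e]: thus [e]
   lies between [c] and [y]. *)
move=> Dy; have [m [b1 b2 b3]] := median c e y.
have Dm : D m by apply: cD De Dy b3.
have cm := min _ _ Cc Dm.
have me : m = e by apply: d_eq0; move: b1; rewrite /between (d_sym c e) (d_sym e m); lia.
subst m; move: b2; rewrite /between /halfspace /= (d_sym y c) (d_sym c e) => b2.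
have := d_tri y e c1; rewrite (d_sym y e); lia.
Qed.

Lemma same_side_halfspace h a b x y : crosses h a b -> same_side h x y ->
  W a b x <-> W a b y.
Proof.
move=> hab; have [ab _] := hab.
elim=> {x y} [x y [xy off]|x|x y _ ->|x y z _ -> _ ->] //.
have imp u v : adjacent u v -> ~ sval h [set u; v] -> W a b u -> W a b v.
  move=> uv nuv wu; apply: contrapT => /(halfspaceC _ ab).
  by move/(crossesP hab uv wu) => -[].
split; apply: imp => //; first exact: adjacentC.
by rewrite setUC.
Qed.

(** Disjoint carriers are convex, so [separation] yields an edge between them, and its hyperplane
    separates. No hyperplane separates [h] and [k] at a common vertex of their carriers. *)
Lemma contactP h k : contact_adjacent h k <-> h <> k /\ carrier h `&` carrier k !=set0.
Proof.
split=> [[hk ns]|[hk [v [[v1 [vv1 hv]] [v2 [vv2 kv]]]]]]; last first.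
  split=> // -[m [_ _ sep]]; apply: (sep _ _ v v hv kv).
  - by left. - by left. - exact: rst_refl.
split=> //; apply/set0P/eqP => disj; apply: ns.
have [a [b [ab hab kba]]] := separation (@carrier_convex h) (@carrier_convex k)
  (carrier_neq0 h) (carrier_neq0 k) disj.
have [m mab] := adjacent_crosses ab.
have no_cross u v : W a b u -> W a b v -> ~ crosses m u v.
  move=> wu wv /[dup] -[uv _] /(crossesP mab uv wu) /(halfspaceC _ ab).
  exact.
have no_cross' u v : W b a u -> W b a v -> ~ crosses m u v.
  move=> wu wv /[dup] -[uv _] /(crossesP (crossesC mab) uv wu).
  by move/(halfspaceC _ (adjacentC ab)).
exists m; split.
- move=> mh; have [v [v1 hv]] := carrier_neq0 h; have [cv cv1] := crosses_carrier hv.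
  by apply: (no_cross v v1); [exact: hab|exact: hab|rewrite mh].
- move=> mk; have [v [v1 kv]] := carrier_neq0 k; have [cv cv1] := crosses_carrier kv.
  by apply: (no_cross' v v1); [exact: kba|exact: kba|rewrite mk].
- have inN l f x : sval l f -> f x -> carrier l x.
    move=> /hyperplane_crosses[u [v [/crosses_carrier[? ?] ->]]].
    by move=> [->|->].
  move=> f f' x y hf kf' fx f'y ss.
  have /hab/(same_side_halfspace mab ss) := inN _ _ _ hf fx.
  by have /kba/(halfspaceC _ ab) := inN _ _ _ kf' f'y.
Qed.

(** Induction, intersecting all other sets with the last one. These intersections still meet
    pairwise: a median of points taken from the three pairwise intersections lies in all three sets.
    The case [i = j] of the hypothesis gives nonemptiness. *)
Lemma helly n (F : nat -> set X) : (forall i, i < n -> convex (F i)) ->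
  (forall i j, i < n -> j < n -> F i `&` F j !=set0) ->
  exists v, forall i, i < n -> F i v.
Proof.
elim: n F => [|n IH] F cF iF; first by have [[[v _] _] _] := X_sc; exists v.
have [n0|n0] := posnP n.
  have [v [Fv _]] := iF 0 0 isT isT.
  by exists v => i; rewrite n0 ltnS leqn0 => /eqP ->.
have [i lt_in|i j lt_in lt_jn|v Fv] := IH (fun i => F i `&` F n).
- by apply: convexI; apply: cF => //; exact: ltnW.
- have [|x [xi xj]] := iF i j _ (ltnW lt_jn); first exact: ltnW.
  have [|y [yi yn]] := iF i n _ (ltnSn n); first exact: ltnW.
  have [|z [zj zn]] := iF j n _ (ltnSn n); first exact: ltnW.
  have [m [b1 b2 b3]] := median x y z.
  exists m; split; split.
  + by apply: cF xi yi b1; exact: ltnW. + by apply: cF yn zn b3.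
  + by apply: cF xj zj b2; exact: ltnW. + by apply: cF yn zn b3.
exists v => i; rewrite ltnS leq_eqVlt => /predU1P[->|/Fv[]//].
by have [] := Fv 0 n0.
Qed.

Definition star v : set (hyperplane X) := [set h | carrier h v].

Lemma finite_clique (A : set (hyperplane X)) : finite_set A ->
  (forall h k, A h -> A k -> h <> k -> contact_adjacent h k) ->
  exists v, A `<=` star v.
Proof.
move=> finA cA; have [s As] := (@finite_seqP {classic hyperplane X} A).1 finA.
case: s => [|h0 s] in As.
  by have [[[v _] _] _] := X_sc; exists v => h; rewrite As.
pose F i := carrier (nth h0 (h0 :: s : seq {classic hyperplane X}) i).
have inA i : i < (size s).+1 -> A (nth h0 (h0 :: s) i).
  by move=> lt; rewrite As; apply: (@mem_nth {classic hyperplane X}).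
have [i _|i j /inA Ai /inA Aj|v Fv] := @helly (size s).+1 F.
- exact: carrier_convex.
- have [E|ne] := pselect (nth h0 (h0 :: s) i = nth h0 (h0 :: s) j).
    by rewrite /F E setIid; exact: carrier_neq0.
  by have /contactP[] := cA _ _ Ai Aj ne.
exists v => h; rewrite As => hs.
have := Fv (index (h : {classic hyperplane X}) (h0 :: s)).
by rewrite /F nth_index // => h'; apply: h'; rewrite index_mem.
Qed.

End Hyperplanes.

(** * Extremal vertices *)

Section Extremal.
Variable X : cube_system.
Hypothesis X_cubical : cubical_complex X.
Hypothesis X_flag : forall v : X, flag_link v.
Hypothesis X_sc : simply_connected X.
Implicit Types (x y z a b c u v w : X) (h k m : hyperplane X) (f : X -> X).

Local Notation d := (dist X_sc).

Lemma link_edge v a : adjacent v a -> is_edge [set v; a] /\ [set v; a] v.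
Proof. by move=> va; split; [exists v, a|left]. Qed.

Definition link_to v a (va : adjacent v a) : link v :=
  exist (fun e : set X => is_edge e /\ e v) [set v; a] (link_edge va).

Lemma link_vertexP v (e : link v) : exists2 a, adjacent v a & sval e = [set v; a].
Proof.
case: e => e /= [[x [y [xy ->]]] [->|->]]; first by exists y.
by exists x; [exact: adjacentC|rewrite setUC].
Qed.

Lemma extremal_intro v a : adjacent v a ->
  (forall y, adjacent v y -> y <> a -> exists z, sq v y z a) -> extremal v.
Proof.
move=> va sqv; exists (link_to va) => e ne.
have [y vy ey] := link_vertexP e.
have ya : y <> a by move=> ya; apply: ne; apply: link_vertex_eq; rewrite ey ya.
split=> [E|]; first by apply: ne.
rewrite /= ey; apply/(span_squareP X_cubical va vy); first exact/nesym.
by have [z /sq_rev] := sqv y vy ya; exists z.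
Qed.

Lemma between_adjacent x y : x <> y ->
  exists2 x1, adjacent x x1 & between X_sc x x1 y.
Proof.
move=> xy; have [||x1 [xx1 d1 _]] := @between_step X X_cubical X_flag X_sc x y y.
- by rewrite /between distxx addn0.
- exact/nesym.
- by exists x1 => //; rewrite /between (dist_adj1 X_cubical X_flag X_sc xx1) -d1.
Qed.

Lemma star_sub v w : ~ extremal v -> star v `<=` star w -> v = w.
Proof.
move=> next sub; apply: contrapT => vw; apply: next.
have [x1 vx1 b] := between_adjacent vw.
(* [x1] is the apex: the carrier of each [u] crossing an edge at [v] contains [v] and [w], hence
   [x1] by convexity, and [carrier_sq] gives the square. *)
apply: (extremal_intro vx1) => y vy yx1; have [u uvy] := adjacent_crosses vy.
have uv : star v u by exists y.
apply: (carrier_sq X_cubical X_flag X_sc uvy _ vx1).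
  exact: (carrier_convex X_cubical X_flag) uv (sub _ uv) b.
by move/(crosses_same X_cubical X_flag X_sc uvy).
Qed.

Lemma star_finite v : uniformly_locally_finite X -> finite_set (star v).
Proof.
move=> [N /(_ v) ulf].
have ex (e : link v) : exists h, sval h (sval e).
  have [a /adjacent_crosses[h [_ ha]] ea] := link_vertexP e.
  by exists h; rewrite ea.
pose g (e : link v) := projT1 (cid (ex e)).
have fin : finite_set [set: link v] by apply: card_le_finite ulf _; exact: finite_II.
apply: sub_finite_set (finite_image g fin) => h [w [vw hvw]].
exists (link_to vw) => //; apply: hyperplane_uniq hvw.
exact: (projT2 (cid (ex (link_to vw)))).
Qed.

Lemma star_contact v h k : star v h -> star v k -> h <> k -> contact_adjacent h k.
Proof.
by move=> hv kv hk; apply/(contactP X_cubical X_flag X_sc); split=> //; exists v.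
Qed.

(** * Graph automorphisms preserve cubes *)

(** The quadrangle condition seen from [a] completes [b], [c], [e] to a square whose fourth corner
    has distance 0 from [a]. *)
Lemma cycle4_sq a b c e : adjacent a b -> adjacent b c -> adjacent c e ->
  adjacent e a -> a <> c -> b <> e -> sq a b c e.
Proof.
move=> ab bc ce ea ac be.
have dab := dist_adj1 X_cubical X_flag X_sc ab.
have dae := dist_adj1 X_cubical X_flag X_sc (adjacentC ea).
have dac : d a c = 2.
  have [|d0] := dist_adj X_cubical X_flag X_sc a bc; first by rewrite dab.
  by case: ac; apply/esym/(@dist_eq0 X X_sc); move: d0; rewrite dab => -[].
have [w sqc [/dist_eq0 wa]] :=
  quadrangle X_cubical X_flag (adjacentC bc) ce be dac dab dae.
by subst w; do 2!apply: sq_rot; exact: sq_rev.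
Qed.

Lemma sq_image f x y z t : injective f ->
  (forall a b, adjacent a b -> adjacent (f a) (f b)) ->
  sq x y z t -> sq (f x) (f y) (f z) (f t).
Proof.
move=> inj adj /[dup] /sq_diag[xz yt] [_ xy yz zt tx].
by apply: cycle4_sq; do ?[exact: adj]; move/inj.
Qed.

(** [D] is closed under completing squares, so it suffices that it contains the images of [v] and of
    its neighbours in [C]. *)
Lemma cube_image_sub f C D v : injective f ->
  (forall a b, adjacent a b -> adjacent (f a) (f b)) ->
  cube C -> cube D -> C v -> D (f v) ->
  (forall w, C w -> adjacent v w -> D (f w)) -> f @` C `<=` D.
Proof.
move=> inj adj cC cD Cv Dv Dw _ [w Cw <-].
have [n [phi chart]] := cube_chartP X_cubical cC.
have [s vs] := chart_onto chart Cv; have [t ->] := chart_onto chart Cw.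
(* Induction on the number of coordinates in which [t] differs from [s]; two such coordinates give a
   square whose other three corners are covered. *)
have [k le] := ubnP #|[pred i | t i != s i]|; elim: k => // k IH in t le *.
have less i (u : {ffun _ -> bool}) : u i != s i ->
    #|[pred j | flip i u j != s j]| < #|[pred j | u j != s j]|.
  move=> ui; apply: proper_card; apply/properP; split.
    apply/fintype.subsetP => j; rewrite !inE ffunE; have [->|] := eqVneq j i => //.
    by rewrite addbF.
  exists i; rewrite !inE // ffunE eqxx addbT.
  by move: ui; case: (u i); case: (s i).
have [i ti|ts] := pickP [pred i | t i != s i]; last first.
  suff -> : t = s by rewrite -vs.
  by apply/ffunP => i; apply/eqP; rewrite -[_ == _]negbK; exact: negbT (ts i).
have [j /andP[/eqP ji tj]|tsi] := pickP [pred j | (j != i) && (t j != s j)].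
  have tj' : flip i t j != s j by rewrite ffunE (introF eqP ji) addbF.
  have Di : D (f (phi (flip i t))) by apply: IH; exact: leq_trans (less _ _ ti) le.
  have Dj : D (f (phi (flip j t))) by apply: IH; exact: leq_trans (less _ _ tj) le.
  have Dij : D (f (phi (flip j (flip i t)))).
    apply: IH; apply: leq_trans (less _ _ tj') _; apply: ltnW.
    exact: leq_trans (less _ _ ti) le.
  apply: (cube_square_closed X_cubical cD Dij Di Dj).
  apply: sq_image => //; apply: sq_rot; apply: sq_rot.
  exact: (chart_sq chart t ji).
apply: Dw; first exact: (chart_in chart).
rewrite vs; apply/(chart_adj chart); exists i; apply/ffunP => j; rewrite ffunE.
have [->|ji] := eqVneq j i.
  by move: ti => /=; case: (t i); case: (s i).
by rewrite addbF; apply/eqP; move: (tsi j); rewrite /= ji => /negbT; rewrite negbK.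
Qed.

(** The images of the neighbours of one vertex of [C] pairwise span squares, so the flag condition
    yields a cube [D] through them. [cube_image_sub] for [f] and for [g] gives the two
    inclusions. *)
Lemma cube_image f g C : cancel f g -> cancel g f ->
  (forall a b, adjacent a b -> adjacent (f a) (f b)) ->
  (forall a b, adjacent a b -> adjacent (g a) (g b)) ->
  cube C -> cube (f @` C).
Proof.
move=> fK gK fadj gadj cC; have [n [phi chart]] := cube_chartP X_cubical cC.
have finj := can_inj fK; have ginj := can_inj gK.
pose s : {ffun 'I_n -> bool} := [ffun=> false]; pose v := phi s.
have Cv : C v by exact: (chart_in chart).
pose A := [set f w | w in [set w | C w /\ adjacent v w]].
have [|_ [w [_ vw] <-]|_ _ [p [Cp vp] <-] [q [Cq vq] <-] pq|D [cD Dv DA]] :=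
    @flag_cube X X_cubical X_flag (f v) A.
- apply: finite_image; apply: (@sub_finite_set _ _ (range phi)).
    by move=> w [/(chart_onto chart)[t ->] _]; exists t.
  exact/finite_image/finite_finset.
- exact: fadj.
- move: vp vq pq; have [sp ->] := chart_onto chart Cp.
  have [sq' ->] := chart_onto chart Cq.
  move=> /(chart_adj chart)[i ->] /(chart_adj chart)[j ->] ij.
  exists (f (phi (flip i (flip j s)))); apply: sq_image => //.
  by apply: (chart_sq chart) => E; apply: ij; rewrite E.
suff -> : f @` C = D by [].
apply/seteqP; split.
  apply: (cube_image_sub finj fadj cC cD Cv Dv) => w Cw vw.
  by apply/(DA _ (fadj _ _ vw)); exists w.
have gD : g @` D `<=` C.
  apply: (cube_image_sub ginj gadj cD cC Dv); first by rewrite fK.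
  move=> w Dw fvw.
  by have [w' [Cw' _] <-] := (DA _ fvw).1 Dw; rewrite fK.
by move=> w Dw; exists (g w); [apply: gD; exists w|exact: gK].
Qed.

Lemma crossing_edge_eq h (E : set X) p q :
  sval h E -> E p -> crosses h p q -> E = [set p; q].
Proof.
move=> /hyperplane_crosses[x [y [hxy ->]]] [->|->] hpq.
  by rewrite (crosses_same X_cubical X_flag X_sc hxy hpq).
by rewrite setUC (crosses_same X_cubical X_flag X_sc (crossesC hxy) hpq).
Qed.

(** * Links in the cube complex of a hyperplane *)

Section HyperplaneExtremal.
Variables (h : hyperplane X) (v v' : X).
Hypothesis hv : crosses h v v'.

Local Notation Y := (hyperplane_complex h).

Definition midpoint p q (hpq : crosses h p q) : Y := exist _ [set p; q] (proj2 hpq).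

Lemma midpointP (e : Y) p q (hpq : crosses h p q) : sval e p -> e = midpoint hpq.
Proof.
move=> ep; apply/eq_sig_hprop; first by move=> ?; exact: Prop_irrelevance.
exact: crossing_edge_eq (svalP e) ep hpq.
Qed.

Lemma midpoint_neq p q p' q' (hpq : crosses h p q) (hpq' : crosses h p' q') :
  p' <> p -> p' <> q -> midpoint hpq <> midpoint hpq'.
Proof.
move=> pp pq E; have : [set p; q] p'.
  by rewrite (_ : [set p; q] = [set p'; q']); [left|exact: (congr1 sval E)].
by case.
Qed.

Local Notation e0 := (midpoint hv).

Lemma hyperplane_link_edge y y' (hy : crosses h y y') : sq v v' y' y ->
  is_edge [set e0; midpoint hy] /\ [set e0; midpoint hy] e0.
Proof.
move=> sqv; split; last by left.
exists e0, (midpoint hy); split=> //.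
have [_ v'y] := sq_diag sqv; have [[c4 _] _ _ _ [yv _]] := sqv.
split; first by apply: midpoint_neq => //; exact/nesym.
split; first by exists e0; left.
exists (set4 v v' y' y) => //; apply/seteqP; split=> [_ [->|->] w /= [->|->]|e /= sube].
- by constructor 1. - by constructor 2. - by constructor 4. - by constructor 3.
have [p [q [hpq eE]]] := hyperplane_crosses (svalP e).
have ep : sval e p by rewrite eE; left.
have [E|E|E|E] := sube p ep; rewrite E in ep.
- by left; exact: midpointP.
- by left; apply: midpointP; rewrite (crossing_edge_eq (svalP e) ep (crossesC hv)); right.
- by right; apply: midpointP; rewrite (crossing_edge_eq (svalP e) ep (crossesC hy)); right.
- by right; exact: midpointP.
Qed.

(** The cube [C] of [X] that cuts out [E] contains a square on [v v']. The side of it opposite to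
    [v v'] also crosses [h], so its midpoint is the other end of [E]. *)
Lemma hyperplane_linkP (E : link e0) : exists y y' (hy : crosses h y y'),
  sq v v' y' y /\ sval E = [set e0; midpoint hy].
Proof.
case: E => E /= [[e1 [e2 [[ne [_ [C cC CE]]] EE]]] Ee0].
have [e [Ee ne0 Esub]] : exists e, [/\ E e, e <> e0 &
    forall e', E e' -> e' = e0 \/ e' = e].
  move: Ee0; rewrite EE => -[->|->].
    by exists e2; split; [right|exact/nesym|].
  by exists e1; split=> [|//|e']; [left|move=> [->|->]; [right|left]].
rewrite -EE in CE.
have e0C : sval e0 `<=` C by move: Ee0; rewrite CE.
have eC : sval e `<=` C by move: Ee; rewrite CE.
have Cv : C v by apply: e0C; left.
have Cv' : C v' by apply: e0C; right.
have [p [q [hpq eE]]] := hyperplane_crosses (svalP e).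
have ep : sval e p by rewrite eE; left.
have pv : p <> v by move=> pv; apply: ne0; apply: midpointP; rewrite -pv.
have pv' : p <> v'.
  move=> pv'; apply: ne0; apply: midpointP; rewrite pv' in ep.
  by rewrite (crossing_edge_eq (svalP e) ep (crossesC hv)); right.
have [n [phi chart]] := cube_chartP X_cubical cC.
have [s vs] := chart_onto chart Cv; have [s' vs'] := chart_onto chart Cv'.
have [t pt] := chart_onto chart (eC _ ep).
have [vv' _] := hv; have [i si] : exists i, s' = flip i s.
  by apply/(chart_adj chart); rewrite -vs -vs'.
(* A vertex [p] of [C] other than [v] and [v'] differs from [v] in a direction other than [i]. *)
have [j /andP[ji tj]] : exists j, (j != i) && (t j != s j).
  apply: contrapT => /forallNP nj.
  have ts j : j != i -> t j = s j.
    by move=> ji; apply/eqP; have /negP := nj j; rewrite ji negbK.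
  have [ti|ti] := eqVneq (t i) (s i).
    apply: pv; rewrite pt vs; congr phi; apply/ffunP => j.
    by have [->|/ts] := eqVneq j i.
  apply: pv'; rewrite pt vs' si; congr phi; apply/ffunP => j; rewrite ffunE.
  have [->|/ts->] := eqVneq j i; last by rewrite addbF.
  by move: ti; case: (t i); case: (s i).
have ij : i <> j by move=> E'; rewrite E' eqxx in ji.
have := chart_sq chart s ij; rewrite -si -vs -vs'.
set y' := phi (flip i (flip j s)); set y := phi (flip j s) => sqv.
have hy := crosses_sq sqv hv; exists y, y', hy; split=> //.
have [_ v'y] := sq_diag sqv; have [_ _ _ _ [yv _]] := sqv.
have Ey : E (midpoint hy).
  by rewrite CE => w /= [->|->]; exact: (chart_in chart).
have eyE : midpoint hy = e.
  case: (Esub _ Ey) => // E0; case: (@midpoint_neq _ _ _ _ hv hy) => //.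
  exact/nesym.
apply/seteqP; split=> [w /Esub[->|->]|w [->|->] //]; first by left.
by right.
Qed.

(* a spans the apex of the link of e0: the square of the hyperplane with sides
   y and a is cut out of the 3-cube spanned at v by v', y and a. *)
Lemma hyperplane_extremal a a' : sq v v' a' a ->
  (forall y y', sq v v' y' y -> y <> a -> exists z, sq v y z a) -> extremal e0.
Proof.
move=> sqa sqy; have ha := crosses_sq sqa hv.
exists (exist (fun E : set Y => is_edge E /\ E e0) _ (hyperplane_link_edge ha sqa)) => E ne.
have [y [y' [hy [sqv EE]]]] := hyperplane_linkP E.
have ya : y <> a.
  move=> ya; apply: ne; apply: link_vertex_eq; rewrite EE /=; congr [set _; _].
  by apply: midpointP; rewrite -ya; left.
split=> [E'|]; first exact: ne.
have [z sqz] := sqy y y' sqv ya.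
have [abc [D [_ sq1 sq2 cD DE]]] := cube3 X_cubical X_flag sqv sqz sqa.
have hz := crosses_sq sq1 hy.
have [[_ nva] [_ nvy]] := (sq_diag sqa, sq_diag sqv).
have [nvz nya] := sq_diag sqz.
have [_ ny'z] := sq_diag sq1; have [_ na'z] := sq_diag sq2.
have [_ vv' v'y' y'y yv] := sqv; have [_ _ yz za av] := sqz.
have da := dist_adj X_cubical X_flag X_sc.
have vy1 := dist_adj1 X_cubical X_flag X_sc (adjacentC yv).
have va1 := dist_adj1 X_cubical X_flag X_sc (adjacentC av).
have vv1 := dist_adj1 X_cubical X_flag X_sc vv'.
(* Parity: [z] and [y'] are adjacent to [y], so their distance from [v] is even, whereas [v'] and
   [a] are at distance 1. *)
have zv' : z <> v'.
  by move=> zv'; have := da v _ _ yz; rewrite zv' vy1 vv1; lia.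
have ay' : a <> y'.
  by move=> ay'; have := da v _ _ y'y; rewrite -ay' vy1 va1; lia.
exists (set4 e0 (midpoint hy) (midpoint hz) (midpoint ha)); split.
- split; last first.
    case: yv yz za av => yv _ [yz _] [za _] [av _].
    apply: card_set4; do 5?[by apply: midpoint_neq => //; exact/nesym].
    by apply: nesym; apply: midpoint_neq => //; exact/nesym.
  split; first by exists e0; constructor 1.
  exists D => //; rewrite DE; apply/seteqP; split=> [e|e /= sube].
    by case=> -> w /= [->|->]; [left; constructor 1|left; constructor 2|
      left; constructor 4|left; constructor 3|right; constructor 4|
      right; constructor 3|right; constructor 1|right; constructor 2].
  have [p [q [hpq eE]]] := hyperplane_crosses (svalP e).
  have ep : sval e p by rewrite eE; left.
  have other r r' : sval e r' -> crosses h r r' -> sval e r.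
    by move=> er' /crossesC hr; rewrite (crossing_edge_eq (svalP e) er' hr); right.
  have [[]|[]] := sube p ep => Ep; rewrite Ep in ep.
  + by constructor 1; exact: midpointP.
  + by constructor 1; apply: midpointP; exact: (other _ _ ep hv).
  + by constructor 2; apply: midpointP; exact: (other _ _ ep hy).
  + by constructor 2; exact: midpointP.
  + by constructor 4; exact: midpointP.
  + by constructor 4; apply: midpointP; exact: (other _ _ ep ha).
  + by constructor 3; apply: midpointP; exact: (other _ _ ep hz).
  + by constructor 3; exact: midpointP.
- by move=> e /= [->|->]; [constructor 1|constructor 4].
- by rewrite EE => e [->|->]; [constructor 1|constructor 2].
Qed.

End HyperplaneExtremal.

(* If k <> h has the carrier of h, its edge at v spans a square of h with every
   edge of h at the midpoint of v v', which is therefore extremal in h. *)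
Lemma carrier_inj h k : (forall e : hyperplane_complex h, ~ extremal e) ->
  carrier h = carrier k -> h = k.
Proof.
move=> next hk; apply: contrapT => nhk.
have [v [v' hv]] := carrier_neq0 h; have [cv cv'] := crosses_carrier hv.
have [vv' _] := hv; apply: (next (midpoint hv)).
have [a ka] : carrier k v by rewrite -hk.
have [va _] := ka.
have [||z sqz] := carrier_sq X_cubical X_flag X_sc ka (_ : carrier k v') vv'.
- by rewrite -hk.
- by move=> kv'; apply: nhk; exact: crosses_uniq hv kv'.
apply: (@hyperplane_extremal h v v' hv a z (sq_rev sqz)) => y y' sqy ya.
have [_ _ _ _ yv] := sqy.
have [_ cy] := crosses_carrier (crossesC (crosses_sq sqy hv)).
have [||w sqw] := carrier_sq X_cubical X_flag X_sc ka (_ : carrier k y) (adjacentC yv).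
- by rewrite -hk.
- by move=> ky; apply: ya; exact: (crosses_same X_cubical X_flag X_sc ky ka).
by exists w; exact: sq_rev.
Qed.

(** If [v] and [w] are not adjacent, convexity of carriers puts the first vertex of a geodesic
    between them in every common carrier. If they are, a further vertex [x] in all common carriers
    makes the midpoint of [v w] extremal in the hyperplane [h] crossing that edge. *)
Lemma adjacent_starP v w :
  (forall h (e : hyperplane_complex h), ~ extremal e) ->
  adjacent v w <-> v <> w /\ forall x, star v `&` star w `<=` star x -> x = v \/ x = w.
Proof.
move=> next; split=> [vw|[vw sub]]; last first.
  have [x vx b] := between_adjacent vw.
  case: (sub x) => [h [hv hw]|xv|<- //].
    exact: (carrier_convex X_cubical X_flag) hv hw b.
  by case: vx => -[]; rewrite xv.
split=> [|x]; first by case: vw.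
have [h hv] := adjacent_crosses vw.
(* With [x] on the side of [a], the first step [a1] from [a] towards [x] does not cross [h] and
   gives the apex of the link of the midpoint. *)
have side a b : crosses h a b -> halfspace X_sc a b x ->
    star a `&` star b `<=` star x -> x = a.
  move=> hab wx sub; apply: contrapT => xa.
  have hx : carrier h x by apply: sub; exact: crosses_carrier.
  have ha : carrier h a by case: (crosses_carrier hab).
  have [a1 aa1 b1] := between_adjacent (nesym xa).
  have nb : ~ crosses h a a1.
    move/(crosses_same X_cubical X_flag X_sc hab) => E; move: b1 wx.
    have [ab _] := hab.
    rewrite -E /between /halfspace /= !(distC X_sc x) (dist_adj1 X_cubical X_flag X_sc ab).
    by lia.
  have ha1 : carrier h a1 by exact: (carrier_convex X_cubical X_flag) ha hx b1.
  have [z sqz] := carrier_sq X_cubical X_flag X_sc hab ha1 aa1 nb.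
  apply: (next h (midpoint hab)); apply: (hyperplane_extremal hab sqz).
  move=> y y' sqy ya; have [_ _ _ y'y /adjacentC ay] := sqy.
  have [u uy] := adjacent_crosses ay.
  (* The square carries [u] from the edge [a y] to the edge [b y'], so [u] lies in both stars. *)
  have ux : carrier u x.
    apply: sub; split; first by exists y.
    by exists y'; exact: crosses_sq (sq_rev sqy) uy.
  apply: (carrier_sq X_cubical X_flag X_sc uy) => //.
    have ua : carrier u a by exists y.
    exact: (carrier_convex X_cubical X_flag) ua ux b1.
  by move/(crosses_same X_cubical X_flag X_sc uy).
have [wx|/(halfspaceC X_cubical X_flag X_sc x vw) wx] := pselect (halfspace X_sc v w x).
  by left; exact: side hv wx _.
by right; apply: (side _ _ (crossesC hv) wx); rewrite setIC.
Qed.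

End Extremal.

(** * The action of Aut C(X) on the vertices *)

Section VertexAction.
Variable X : cube_system.
Hypothesis X_CAT0 : CAT0_cube_complex X.
Hypothesis X_ulf : uniformly_locally_finite X.
Hypothesis X_no_extremal : forall v : X, ~ extremal v.
Implicit Types (x y v w : X) (h k : hyperplane X).
Implicit Types (phi psi : graph_aut (contact_graph X)).

Let X_cubical : cubical_complex X. Proof. by case: X_CAT0. Qed.
Let X_sc : simply_connected X. Proof. by case: X_CAT0. Qed.
Let X_flag : forall v : X, flag_link v. Proof. by case: X_CAT0. Qed.

Lemma star_le_eq v w : star v `<=` star w -> v = w.
Proof. apply: (star_sub X_cubical X_flag X_sc); exact: X_no_extremal. Qed.

Lemma graph_autK phi h : val phi^-1%g (val phi h) = h.
Proof. exact: (permfK (val phi)). Qed.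

Lemma graph_autVK phi h : val phi (val phi^-1%g h) = h.
Proof. exact: (permfVK (val phi)). Qed.

Lemma star_image_sub phi v :
  exists w, forall h, star v h -> star w (val phi h).
Proof.
have /asboolP phiP := valP phi.
have [|_ _ [h hv <-] [k kv <-] hk|w sub] :=
    @finite_clique X X_cubical X_flag X_sc (val phi @` star v).
- exact/finite_image/star_finite.
- apply/(phiP h k); apply: (star_contact X_cubical X_flag X_sc hv kv) => E.
  by apply: hk; rewrite E.
by exists w => h hv; apply: sub; exists h.
Qed.

(** The image of [star v] lies in some [star w], and the preimage of [star w] in some [star u]. Then
    [star v] lies in [star u], so [u = v] and both inclusions are equalities. *)
Lemma star_image phi v : exists w, forall h, star v h <-> star w (val phi h).
Proof.
have [w vw] := star_image_sub phi v; have [u wu] := star_image_sub phi^-1%g w.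
have sub h : star w (val phi h) -> star u h by move=> /wu; rewrite graph_autK.
have vu : v = u by apply: star_le_eq => h /vw/sub.
by exists w => h; split=> [/vw|/sub]; rewrite // vu.
Qed.

Definition vertex_map phi v : X := projT1 (cid (star_image phi v)).

Lemma vertex_mapP phi v h : star v h <-> star (vertex_map phi v) (val phi h).
Proof. exact: (projT2 (cid (star_image phi v)) h). Qed.

(** One inclusion characterises the image vertex, since comparable stars belong to equal
    vertices. *)
Lemma vertex_map_uniq phi v w :
  (forall h, star v h -> star w (val phi h)) -> vertex_map phi v = w.
Proof.
move=> vw; apply: star_le_eq => h; rewrite -(graph_autVK phi h).
by move=> vh; apply: vw; exact: (vertex_mapP phi v _).2 vh.
Qed.

Lemma vertex_map_mul phi psi v :
  vertex_map (phi * psi)%g v = vertex_map phi (vertex_map psi v).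
Proof. by apply: vertex_map_uniq => h /(vertex_mapP psi)/(vertex_mapP phi). Qed.

Lemma vertex_map1 v : vertex_map 1%g v = v.
Proof. exact: vertex_map_uniq. Qed.

Lemma vertex_mapK phi : cancel (vertex_map phi) (vertex_map phi^-1%g).
Proof. by move=> v; rewrite -vertex_map_mul mulVg vertex_map1. Qed.

Lemma vertex_mapVK phi : cancel (vertex_map phi^-1%g) (vertex_map phi).
Proof. by move=> v; rewrite -vertex_map_mul mulgV vertex_map1. Qed.

Definition vertex_action phi : permutation X :=
  Permutation (vertex_mapK phi) (vertex_mapVK phi).

Lemma vertex_action_mul : {morph vertex_action : phi psi / (phi * psi)%g}.
Proof. by move=> phi psi; apply: permutationP => v; exact: vertex_map_mul. Qed.

Lemma star_cube_aut (g : cube_aut X) v h :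
  star v h -> star (val g v) (hyperplane_image g h).
Proof.
move=> [w [vw hvw]]; exists (val g w); split; first exact: cube_aut_adjacent.
by exists [set v; w]; rewrite // image_setU !image_set1.
Qed.

Lemma vertex_action_contact (g : cube_aut X) :
  vertex_action (contact_action g) = val g.
Proof.
by apply: permutationP => v; apply: vertex_map_uniq => h; exact: star_cube_aut.
Qed.

Lemma contact_action_inj : injective (@contact_action X).
Proof.
move=> g g' E; apply: val_inj.
by rewrite -(vertex_action_contact g) E vertex_action_contact.
Qed.

Hypothesis X_no_hyperplane_extremal :
  forall h (e : hyperplane_complex h), ~ extremal e.

Lemma vertex_map_adjacent phi v w :
  adjacent v w -> adjacent (vertex_map phi v) (vertex_map phi w).
Proof.
move=> /(adjacent_starP X_cubical X_flag X_sc v w X_no_hyperplane_extremal)[vw sub].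
apply/(adjacent_starP X_cubical X_flag X_sc _ _ X_no_hyperplane_extremal); split.
  by move/(can_inj (vertex_mapK phi)).
move=> x subx; rewrite -(vertex_mapVK phi x) in subx *.
have [h [hv hw]|->|->] := sub (vertex_map phi^-1%g x); last 2 first.
- by left.
- by right.
apply/(vertex_mapP phi)/subx.
  by split; [exact: (vertex_mapP phi v h).1|exact: (vertex_mapP phi w h).1].
Qed.

Lemma vertex_action_cubical phi : `[< cubical_automorphism (vertex_action phi) >].
Proof.
apply/asboolP => C; split; last first.
  exact: (cube_image X_cubical X_flag X_sc (vertex_mapK phi) (vertex_mapVK phi)
    (@vertex_map_adjacent phi) (@vertex_map_adjacent phi^-1%g)).
move=> /(cube_image X_cubical X_flag X_sc (vertex_mapVK phi) (vertex_mapK phi)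
    (@vertex_map_adjacent phi^-1%g) (@vertex_map_adjacent phi)).
rewrite image_comp (_ : _ \o _ = id) ?image_id //.
exact/funext/vertex_mapK.
Qed.

Definition cube_action phi : cube_aut X :=
  exist (fun f : permutation X => `[< cubical_automorphism f >]) _
    (vertex_action_cubical phi).

Lemma cube_action_mul : {morph cube_action : phi psi / (phi * psi)%g}.
Proof. by move=> phi psi; apply: val_inj; exact: vertex_action_mul. Qed.

Lemma contact_actionK : cancel (@contact_action X) cube_action.
Proof. by move=> g; apply: val_inj; exact: vertex_action_contact. Qed.

(** Both hyperplanes obtained from [h] have the same carrier, since [star_cube_aut] and
    [vertex_mapP] each describe it as the image of the carrier of [h] under [vertex_map phi];
    [carrier_inj] concludes. *)
Lemma cube_actionK : cancel cube_action (@contact_action X).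
Proof.
move=> phi; apply: val_inj; apply: permutationP => h.
apply: (carrier_inj X_cubical X_flag X_sc); first exact: X_no_hyperplane_extremal.
apply/seteqP; split=> x; rewrite -(vertex_mapVK phi x).
  move=> /(@star_cube_aut (cube_action phi)^-1%g) /=.
  rewrite hyperplane_imageK vertex_mapK.
  by move/(vertex_mapP phi).
by move=> /(vertex_mapP phi (vertex_map phi^-1%g x)) /(@star_cube_aut (cube_action phi)).
Qed.

End VertexAction.

Theorem mainTheorem1 (X : cube_system)
    (X_CAT0 : CAT0_cube_complex X)
    (X_ulf : uniformly_locally_finite X)
    (X_no_extremal : forall v : X, ~ extremal v) :
  exists rho : {multiplicative graph_aut (contact_graph X) -> permutation X},
    [/\ forall g : cube_aut X, rho (contact_action g) = val g,
        injective (@contact_action X) &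
        (forall (w : hyperplane X) (e : hyperplane_complex w), ~ extremal e) ->
        exists rho_cube :
            {multiplicative graph_aut (contact_graph X) -> cube_aut X},
          [/\ forall h, val (rho_cube h) = rho h,
              cancel (@contact_action X) rho_cube &
              cancel rho_cube (@contact_action X)]].
Proof.
pose rho_mul := isMultiplicative.Build _ _ _
  (vertex_action_mul X_CAT0 X_ulf X_no_extremal).
pose rho : {multiplicative _ -> _} := 
  HB.pack (vertex_action X_CAT0 X_ulf X_no_extremal) rho_mul.
exists rho; split; first exact: vertex_action_contact.
  exact: (contact_action_inj X_CAT0 X_ulf X_no_extremal).
move=> no_ext.
pose rho_cube_mul := isMultiplicative.Build _ _ _
  (cube_action_mul X_CAT0 X_ulf X_no_extremal no_ext).
pose rho_cube : {multiplicative _ -> _} := 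
  HB.pack (cube_action X_CAT0 X_ulf X_no_extremal no_ext) rho_cube_mul.
exists rho_cube; split=> //; first exact: contact_actionK.
exact: cube_actionK.
Qed.
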